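(* Let $V$ be a finite-dimensional complex vector space with symplectic form $\omega$, and $G$ a finite group acting faithfully and symplectically (linearly) on $V$ with $(\wedge^2V^* )^G=\mathbb C\omega$. Let $\mathcal S\subset G$ be the set of symplectic reflections. Let $\kappa:\wedge^2V\to\mathbb C[G]$ be a linear $G$-equivariant function, and let $\mathsf H_\kappa$ be the quotient of $\mathbb C[G]\ltimes\mathbf T(V)$ by the relations $[x,y]=\kappa(x,y)$, $x,y\in V$. Put an increasing filtration on $\mathsf H_\kappa$ by $\deg(V)=1$, $\deg(G)=0$, and let $\xi:\mathbb CG\ltimes SV\to\mathrm{gr}\,\mathsf H_\kappa$ be the natural surjective homomorphism. Then $\xi$ is an isomorphism if and only if $\kappa$ has the form $$\kappa(x,y)=t\,\omega(x,y)-2\sum_{s\in\mathcal S}c_s\,\omega_s(x,y)\,s$$ for some $t\in\mathbb C$ and some $G$-invariant function $c:\mathcal S\to\mathbb C$.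
   Context: A symplectic reflection in $G$ is an element $g\in G$ such that $1-g$ has rank $2$ on $V$. For a symplectic reflection $s$, $\omega_s(x,y)$ is $\omega$ applied to the projections of $x,y$ to $\mathrm{Im}(1-s)$ along $\mathrm{Ker}(1-s)$. $\mathbf T(V)$ is the tensor algebra; $G$ acts on $\mathbb C[G]$ and on $\mathcal S$ by conjugation. *)

(* Defs.v *)
From HB Require Import structures.
From mathcomp Require Import all_fingroup.
From mathcomp Require Import all_boot all_order all_algebra.
From mathcomp Require Import generic_quotient.
From mathcomp Require Import boolp reals complex.
From mathcomp.multinomials Require Import monalg.
From mathcomp Require Import finmap.

Set Implicit Arguments.
Unset Strict Implicit.
Unset Printing Implicit Defensive.

Import GRing.Theory.
Local Open Scope ring_scope.
Local Open Scope quotient_scope.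
#[local] Obligation Tactic := idtac.

(* A K-algebra is a ring with a ring morphism [sc] from K to its center; the
   scalar multiple of x by a is [sc a * x].  The library's algType is not used
   because it excludes the zero ring, and an algebra given by generators and
   relations may collapse. *)
HB.mixin Record hasScalars (K : comNzRingType) A of GRing.PzRing A := {
  sc : K -> A;
  sc_is_zmod_morphism : zmod_morphism sc;
  sc_is_monoid_morphism : monoid_morphism sc;
  scC : forall a x, sc a * x = x * sc a
}.
#[short(type="kalgType")]
HB.structure Definition KAlgebra (K : comNzRingType) :=
  {A of GRing.PzRing A & hasScalars K A}.

HB.instance Definition _ (K : comNzRingType) (A : kalgType K) :=
  GRing.isZmodMorphism.Build K A (@sc K A) (@sc_is_zmod_morphism K A).
HB.instance Definition _ (K : comNzRingType) (A : kalgType K) :=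
  GRing.isMonoidMorphism.Build K A (@sc K A) (@sc_is_monoid_morphism K A).

Record algHom (K : comNzRingType) (A B : kalgType K) := AlgHom {
  ah_fun :> A -> B;
  ah_is_zmod_morphism : zmod_morphism ah_fun;
  ah_is_monoid_morphism : monoid_morphism ah_fun;
  ah_sc : forall a, ah_fun (sc a) = sc a
}.

HB.instance Definition _ (K : comNzRingType) (A B : kalgType K)
    (f : algHom A B) :=
  GRing.isZmodMorphism.Build A B f (ah_is_zmod_morphism f).
HB.instance Definition _ (K : comNzRingType) (A B : kalgType K)
    (f : algHom A B) :=
  GRing.isMonoidMorphism.Build A B f (ah_is_monoid_morphism f).

Section AlgHomComp.
Context {K : comNzRingType}.

Lemma ahD (A B : kalgType K) (f : algHom A B) x y : f (x + y) = f x + f y.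
Proof. exact: raddfD. Qed.

Lemma ahM (A B : kalgType K) (f : algHom A B) x y : f (x * y) = f x * f y.
Proof. exact: rmorphM. Qed.

Definition ah_id (A : kalgType K) : algHom A A :=
  @AlgHom K A A idfun (fun _ _ => erefl) (erefl, fun _ _ => erefl)
    (fun=> erefl).

Program Definition ah_comp (A B C : kalgType K) (f : algHom B C)
    (g : algHom A B) : algHom A C := @AlgHom K A C (f \o g) _ _ _.
Next Obligation. by move=> A B C f g x y /=; rewrite !raddfB. Qed.
Next Obligation.
by move=> A B C f g; split=> [|x y] /=; rewrite ?rmorph1 ?rmorphM.
Qed.
Next Obligation. by move=> A B C f g a /=; rewrite !ah_sc. Qed.

Lemma ah_compE (A B C : kalgType K) (f : algHom B C) (g : algHom A B) x :
  ah_comp f g x = f (g x).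
Proof. by []. Qed.

End AlgHomComp.

Definition linear_to (K : comNzRingType) (V : lmodType K) (A : kalgType K)
    (f : V -> A) :=
  forall (a : K) (u v : V), f (a *: u + v) = sc a * f u + f v.

Section Quotient.
Context {K : comNzRingType} {A : kalgType K}.

Record ideal := Ideal {
  ideal_mem :> A -> Prop;
  ideal0 : ideal_mem 0;
  idealD : forall x y, ideal_mem x -> ideal_mem y -> ideal_mem (x + y);
  idealMl : forall a x, ideal_mem x -> ideal_mem (a * x);
  idealMr : forall a x, ideal_mem x -> ideal_mem (x * a)
}.

Program Definition ideal_gen (S : A -> Prop) : ideal :=
  @Ideal (fun x => forall J : ideal, (forall y, S y -> J y) -> J x) _ _ _ _.
Next Obligation. by move=> S J _; apply: ideal0. Qed.
Next Obligation. by move=> S x y Ix Iy J SJ; apply: idealD; auto. Qed.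
Next Obligation. by move=> S a x Ix J SJ; apply: idealMl; auto. Qed.
Next Obligation. by move=> S a x Ix J SJ; apply: idealMr; auto. Qed.

Lemma mem_ideal_gen (S : A -> Prop) x : S x -> ideal_gen S x.
Proof. by move=> Sx J; apply. Qed.

Variable I : ideal.

Lemma idealN x : I x -> I (- x).
Proof. by rewrite -mulN1r; apply: idealMl. Qed.

Lemma idealB x y : I x -> I y -> I (x - y).
Proof. by move=> Ix /idealN; apply: idealD. Qed.

Definition ideal_eq : rel A := fun x y => `[< I (x - y) >].

Lemma ideal_eq_equiv : equiv_class_of ideal_eq.
Proof.
split=> [x|x y|y x z]; first by apply/asboolP; rewrite subrr; apply: ideal0.
  by apply/asboolP/asboolP => /idealN; rewrite opprB.
move=> /asboolP Ixy /asboolP Iyz; apply/asboolP.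
by rewrite -(subrKA y); apply: idealD.
Qed.

Canonical ideal_eq_equiv_rel := EquivRelPack ideal_eq_equiv.
Canonical ideal_eq_encModRel := defaultEncModRel ideal_eq.

Definition quot : Type := {eq_quot ideal_eq}.
HB.instance Definition _ : EqQuotient A ideal_eq quot := EqQuotient.on quot.
HB.instance Definition _ := Choice.on quot.

Definition qpi (x : A) : quot := \pi_quot x.

Lemma qpiP x y : qpi x = qpi y <-> I (x - y).
Proof.
split; first by move/eqmodP/asboolP.
by move=> Ixy; apply/eqmodP/asboolP.
Qed.

Lemma qpiK (x : quot) : qpi (repr x) = x. Proof. exact: reprK. Qed.

Lemma quot_ind (P : quot -> Prop) : (forall x, P (qpi x)) -> forall x, P x.
Proof. by move=> H x; rewrite -[x]qpiK. Qed.

Lemma repr_qpi x : I (repr (qpi x) - x).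
Proof. by apply/qpiP; rewrite qpiK. Qed.

Definition qzero : quot := qpi 0.
Definition qone : quot := qpi 1.
Definition qopp (x : quot) : quot := qpi (- repr x).
Definition qadd (x y : quot) : quot := qpi (repr x + repr y).
Definition qmul (x y : quot) : quot := qpi (repr x * repr y).

Lemma qoppE x : qopp (qpi x) = qpi (- x).
Proof. by apply/qpiP; rewrite -opprD; apply/idealN/repr_qpi. Qed.

Lemma qaddE x y : qadd (qpi x) (qpi y) = qpi (x + y).
Proof.
by apply/qpiP; rewrite opprD addrACA; apply: idealD; apply: repr_qpi.
Qed.

Lemma qmulE x y : qmul (qpi x) (qpi y) = qpi (x * y).
Proof.
apply/qpiP; rewrite -(subrKA (x * repr (qpi y))) -mulrBl -mulrBr.
by apply: idealD; [apply: idealMr|apply: idealMl]; apply: repr_qpi.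
Qed.

Fact qaddA : associative qadd.
Proof. by do 3![elim/quot_ind=> ?]; rewrite !qaddE addrA. Qed.
Fact qaddC : commutative qadd.
Proof. by do 2![elim/quot_ind=> ?]; rewrite !qaddE addrC. Qed.
Fact qadd0 : left_id qzero qadd.
Proof. by elim/quot_ind=> ?; rewrite !qaddE add0r. Qed.
Fact qaddN : left_inverse qzero qopp qadd.
Proof. by elim/quot_ind=> ?; rewrite qoppE qaddE addNr. Qed.
HB.instance Definition _ := GRing.isZmodule.Build quot qaddA qaddC qadd0 qaddN.

Lemma qpiD x y : qpi x + qpi y = qpi (x + y). Proof. exact: qaddE. Qed.

Fact qmulA : associative qmul.
Proof. by do 3![elim/quot_ind=> ?]; rewrite !qmulE mulrA. Qed.
Fact qmul1 : left_id qone qmul.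
Proof. by elim/quot_ind=> ?; rewrite !qmulE mul1r. Qed.
Fact qmulr1 : right_id qone qmul.
Proof. by elim/quot_ind=> ?; rewrite !qmulE mulr1. Qed.
Fact qmulDl : left_distributive qmul +%R.
Proof. by do 3![elim/quot_ind=> ?]; rewrite !(qmulE, qpiD) mulrDl. Qed.
Fact qmulDr : right_distributive qmul +%R.
Proof. by do 3![elim/quot_ind=> ?]; rewrite !(qmulE, qpiD) mulrDr. Qed.
HB.instance Definition _ := GRing.Zmodule_isPzRing.Build quot
  qmulA qmul1 qmulr1 qmulDl qmulDr.

Lemma qpi_is_zmod_morphism : zmod_morphism qpi.
Proof. by move=> x y; rewrite -qpiD; congr (_ + _); rewrite -qoppE. Qed.
Lemma qpi_is_monoid_morphism : monoid_morphism qpi.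
Proof. by split=> // x y; rewrite -qmulE. Qed.
HB.instance Definition _ :=
  GRing.isZmodMorphism.Build A quot qpi qpi_is_zmod_morphism.
HB.instance Definition _ :=
  GRing.isMonoidMorphism.Build A quot qpi qpi_is_monoid_morphism.

Fact qsc_is_zmod_morphism : zmod_morphism (fun a : K => qpi (sc a)).
Proof. by move=> a b; rewrite !raddfB. Qed.
Fact qsc_is_monoid_morphism : monoid_morphism (fun a : K => qpi (sc a)).
Proof. by split=> [|a b]; rewrite ?rmorph1 ?rmorphM. Qed.
Fact qscC (a : K) (x : quot) : qpi (sc a) * x = x * qpi (sc a).
Proof. by elim/quot_ind: x => x; rewrite -!rmorphM scC. Qed.
HB.instance Definition _ := hasScalars.Build K quot
  qsc_is_zmod_morphism qsc_is_monoid_morphism qscC.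

Definition quot_pi : algHom A quot :=
  @AlgHom K A quot qpi qpi_is_zmod_morphism qpi_is_monoid_morphism
    (fun=> erefl).

Lemma quot_pi_eq0 x : quot_pi x = 0 <-> I x.
Proof. by rewrite -(raddf0 quot_pi) qpiP subr0. Qed.

Section Lift.
Variables (B : kalgType K) (f : algHom A B) (f0 : forall x, I x -> f x = 0).

Lemma quot_lift_subproof x : f (repr (qpi x)) = f x.
Proof. by apply/eqP; rewrite -subr_eq0 -(raddfB f); apply/eqP/f0/repr_qpi. Qed.

Program Definition quot_lift : algHom quot B :=
  @AlgHom K quot B (fun x => f (repr x)) _ _ _.
Next Obligation.
do 2![elim/quot_ind=> ?].
by rewrite -(raddfB qpi) !quot_lift_subproof raddfB.
Qed.
Next Obligation.
split; first by rewrite (quot_lift_subproof 1) rmorph1.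
do 2![elim/quot_ind=> ?].
by rewrite -(rmorphM qpi) !quot_lift_subproof rmorphM.
Qed.
Next Obligation. by move=> a; exact: etrans (quot_lift_subproof (sc a)) (ah_sc f a). Qed.

Lemma quot_liftE x : quot_lift (quot_pi x) = f x.
Proof. exact: quot_lift_subproof. Qed.
End Lift.

End Quotient.

Arguments ideal {K} A.
Arguments quot {K A} I.
Arguments quot_pi {K A} I.

Lemma linear_to_comp (K : comNzRingType) (V : lmodType K) (A B : kalgType K)
    (h : algHom A B) (f : V -> A) :
  linear_to f -> linear_to (fun v => h (f v)).
Proof. by move=> lf a u v; rewrite lf raddfD /= rmorphM /= ah_sc. Qed.

Program Definition ah_ker (K : comNzRingType) (A B : kalgType K)
  (h : algHom A B) : ideal A := @Ideal K A (fun x => h x = 0) _ _ _ _.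
Next Obligation. by move=> K A B h; apply: (raddf0 h). Qed.
Next Obligation.
by move=> K A B h x y /= hx hy; rewrite (raddfD h) /= hx hy addr0.
Qed.
Next Obligation. by move=> K A B h a x /= hx; rewrite (rmorphM h) /= hx mulr0. Qed.
Next Obligation. by move=> K A B h a x /= hx; rewrite (rmorphM h) /= hx mul0r. Qed.

Section FreeAlgebra.
Context {K : fieldType} (X : choiceType).
Local Notation fa := {malg K[{fmonom X}]}.

Fact fa_scC (a : K) (x : fa) : malgC a * x = x * malgC a.
Proof.
apply/malgP => k; rewrite mul_malgC mcoeffZ.
rewrite malgM_def fgmulgU raddf_sum /= mulrC.
rewrite [in LHS](monalgE x) raddf_sum /= mulr_suml; apply: eq_bigr => i _.
by rewrite mulm1 !mcoeffU mulrnAl.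
Qed.

HB.instance Definition _ := hasScalars.Build K fa
  (raddfB (@malgC {fmonom X} K))
  (rmorph1 (@malgC {fmonom X} K), rmorphM (@malgC {fmonom X} K)) fa_scC.

Definition fa_gen (x : X) : fa := << fmu x >>.

Lemma fa_ind (P : fa -> Prop) :
  (forall a, P (sc a)) -> (forall x, P (fa_gen x)) ->
  (forall x y, P x -> P y -> P (x + y)) ->
  (forall x y, P x -> P y -> P (x * y)) -> forall x, P x.
Proof.
move=> Psc Pgen PD PM x; rewrite (monalgE x).
elim/big_ind: _ => [||m _]; [by rewrite -(rmorph0 sc); apply: Psc|exact: PD|].
have -> : << x@_m *g m >> = sc x@_m * << m >> :> fa.
  by rewrite malgM_def fgmulUU mulr1 mul1m.
apply: (PM) => //; case: m => m.
elim: m => [|y m IHm]; first by rewrite -fmoneE; apply: (Psc 1).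
have -> : << FMonom (y :: m) >> = fa_gen y * << FMonom m >> :> fa.
  by rewrite malgM_def fgmulUU mulr1 fmuE /mmul /= fmmulE.
exact: PM.
Qed.

Section Lift.
Variables (B : kalgType K) (f : X -> B).

Definition fa_eval (x : fa) : B :=
  \sum_(m <- msupp x) sc x@_m * \prod_(i <- fmonom_val m) f i.

Fact fa_evalEw (d : {fset {fmonom X}}) (x : fa) : (msupp x `<=` d)%fset ->
  fa_eval x = \sum_(m <- d) sc x@_m * \prod_(i <- fmonom_val m) f i.
Proof.
move=> le; rewrite /fa_eval (big_fset_incl _ le) //= => y yd /mcoeff_outdom ->.
by rewrite raddf0 mul0r.
Qed.

Fact fa_evalU a (m : {fmonom X}) :
  fa_eval << a *g m >> = sc a * \prod_(i <- fmonom_val m) f i.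
Proof. by rewrite (fa_evalEw msuppU_le) big_seq_fset1 mcoeffUU. Qed.

Fact fa_eval_is_zmod_morphism : zmod_morphism fa_eval.
Proof.
move=> x y; pose E := (msupp x `|` msupp y `|` msupp (x - y))%fset.
have xE : (msupp x `<=` E)%fset by rewrite /E -fsetUA fsubsetUl.
have yE : (msupp y `<=` E)%fset.
  by rewrite /E (fsetUC (msupp x)) -fsetUA fsubsetUl.
have xyE : (msupp (x - y) `<=` E)%fset by rewrite /E fsubsetUr.
rewrite (fa_evalEw xE) (fa_evalEw yE) (fa_evalEw xyE).
by rewrite -sumrB; apply: eq_bigr => k _; rewrite !raddfB /= mulrBl.
Qed.
HB.instance Definition _ :=
  GRing.isZmodMorphism.Build fa B fa_eval fa_eval_is_zmod_morphism.

Fact fa_eval_is_monoid_morphism : monoid_morphism fa_eval.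
Proof.
split; first by rewrite fa_evalU rmorph1 mul1r fm1 big_nil.
move=> x y; rewrite malgME raddf_sum mulr_suml /=; apply: eq_bigr => i _.
rewrite raddf_sum mulr_sumr /=; apply: eq_bigr => j _.
rewrite fa_evalU rmorphM fmM big_cat /= -!mulrA; congr (_ * _).
by rewrite mulrA scC mulrA.
Qed.

Fact fa_eval_sc a : fa_eval (sc a) = sc a.
Proof. by rewrite /sc /= fa_evalU fm1 big_nil mulr1. Qed.

Definition fa_lift : algHom fa B :=
  AlgHom fa_eval_is_zmod_morphism fa_eval_is_monoid_morphism fa_eval_sc.

Lemma fa_liftE x : fa_lift (fa_gen x) = f x.
Proof. by rewrite /= fa_evalU rmorph1 mul1r fmU big_seq1. Qed.
End Lift.
End FreeAlgebra.

Section Tensor.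
Context {K : fieldType} (V : lmodType K).
Local Notation fa := {malg K[{fmonom V}]}.

Variant tens_rel : fa -> Prop := TensRel a u v :
  tens_rel (fa_gen (a *: u + v) - (sc a * fa_gen u + fa_gen v)).

(* T(V): the free algebra on the set of vectors, modulo linearity of V -> T(V) *)
Definition tens : kalgType K := quot (ideal_gen tens_rel).

Definition tvec (v : V) : tens := quot_pi _ (fa_gen v).

Lemma tvec_linear : linear_to tvec.
Proof.
move=> a u v; rewrite /tvec -(ah_sc (quot_pi (ideal_gen tens_rel))).
by rewrite -rmorphM -raddfD; apply/qpiP/mem_ideal_gen.
Qed.

Lemma tens_ind (P : tens -> Prop) :
  (forall a, P (sc a)) -> (forall v, P (tvec v)) ->
  (forall x y, P x -> P y -> P (x + y)) ->
  (forall x y, P x -> P y -> P (x * y)) -> forall x, P x.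
Proof.
move=> Psc Pgen PD PM x; rewrite -[x](@qpiK _ _ (ideal_gen tens_rel)).
move: (repr x); apply: fa_ind => [a|v|{}x y Px Py|{}x y Px Py].
- exact: Psc.
- exact: Pgen.
- by rewrite raddfD; apply: PD.
- by rewrite rmorphM; apply: PM.
Qed.

Section Lift.
Variables (B : kalgType K) (f : V -> B) (lf : linear_to f).

Lemma tens_lift_subproof x : ideal_gen tens_rel x -> fa_lift f x = 0.
Proof.
move: (fa_lift f) (fa_liftE f) => h hE /(_ (ah_ker h)); apply=> _ [a u v] /=.
by rewrite raddfB raddfD /= rmorphM /= ah_sc !hE lf subrr.
Qed.

Definition tens_lift : algHom tens B := quot_lift tens_lift_subproof.

Lemma tens_liftE v : tens_lift (tvec v) = f v.
Proof. by rewrite quot_liftE fa_liftE. Qed.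
End Lift.

Lemma tens_ext (B : kalgType K) (f g : algHom tens B) :
  (forall v, f (tvec v) = g (tvec v)) -> f =1 g.
Proof.
move=> fg; elim/tens_ind => [a|//|x y fgx fgy|x y fgx fgy].
- by rewrite !ah_sc.
- by rewrite !raddfD /= fgx fgy.
- by rewrite !rmorphM /= fgx fgy.
Qed.

End Tensor.

Section Symmetric.
Context {K : fieldType} (V : lmodType K).

Variant sym_rel : tens V -> Prop := SymRel u v :
  sym_rel (tvec u * tvec v - tvec v * tvec u).

Definition sym : kalgType K := quot (ideal_gen sym_rel).

Definition svec (v : V) : sym := quot_pi _ (tvec v).

Lemma svec_linear : linear_to svec.
Proof. exact/linear_to_comp/tvec_linear. Qed.

Lemma svecC u v : svec u * svec v = svec v * svec u.
Proof.
rewrite /svec -!(rmorphM (quot_pi (ideal_gen sym_rel))).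
by apply/qpiP/mem_ideal_gen.
Qed.

Lemma sym_ind (P : sym -> Prop) :
  (forall a, P (sc a)) -> (forall v, P (svec v)) ->
  (forall x y, P x -> P y -> P (x + y)) ->
  (forall x y, P x -> P y -> P (x * y)) -> forall x, P x.
Proof.
move=> Psc Pgen PD PM x; rewrite -[x](@qpiK _ _ (ideal_gen sym_rel)).
move: (repr x); apply: tens_ind => [a|v|{}x y Px Py|{}x y Px Py].
- exact: Psc.
- exact: Pgen.
- by rewrite raddfD; apply: PD.
- by rewrite rmorphM; apply: PM.
Qed.

Section Lift.
Variables (B : kalgType K) (f : V -> B) (lf : linear_to f).
Hypothesis fC : forall u v, f u * f v = f v * f u.

Lemma sym_lift_subproof x : ideal_gen sym_rel x -> tens_lift lf x = 0.
Proof.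
move: (tens_lift lf) (tens_liftE lf) => h hE /(_ (ah_ker h)).
by apply=> _ [u v] /=; rewrite raddfB /= !(rmorphM h) /= !hE fC subrr.
Qed.

Definition sym_lift : algHom sym B := quot_lift sym_lift_subproof.

Lemma sym_liftE v : sym_lift (svec v) = f v.
Proof. by rewrite quot_liftE tens_liftE. Qed.
End Lift.

Lemma sym_ext (B : kalgType K) (f g : algHom sym B) :
  (forall v, f (svec v) = g (svec v)) -> f =1 g.
Proof.
move=> fg; elim/sym_ind => [a|//|x y fgx fgy|x y fgx fgy].
- by rewrite !ah_sc.
- by rewrite !raddfD /= fgx fgy.
- by rewrite !rmorphM /= fgx fgy.
Qed.

Lemma sym_intertwine (B : kalgType K) (h : algHom sym B) (f : algHom sym sym)
    (u : B) : (forall v, u * h (svec v) = h (f (svec v)) * u) ->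
  forall x, u * h x = h (f x) * u.
Proof.
move=> uv; apply: sym_ind => [a|//|x y IHx IHy|x y IHx IHy].
- by rewrite !ah_sc scC.
- by rewrite !ahD mulrDr mulrDl IHx IHy.
- by rewrite !ahM mulrA IHx -mulrA IHy mulrA.
Qed.

End Symmetric.

Section Representation.
Context {K : fieldType} (gT : finGroupType).

Record linrep (V : vectType K) := LinRep {
  lr_fun :> gT -> 'End(V);
  lr1 : lr_fun 1%g = \1%VF;
  lrM : forall g h, lr_fun (g * h)%g = (lr_fun g \o lr_fun h)%VF
}.

Definition faithful_rep (V : vectType K) (rho : linrep V) := injective rho.

Record algAct (A : kalgType K) := AlgAct {
  aa_fun :> gT -> algHom A A;
  aa1 : forall x, aa_fun 1%g x = x;
  aaM : forall g h x, aa_fun (g * h)%g x = aa_fun g (aa_fun h x)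
}.

Section TensAct.
Context {V : vectType K} (rho : linrep V).

Fact tens_act_subproof g : linear_to (fun v : V => tvec (rho g v)).
Proof. by move=> a u v; rewrite linearP tvec_linear. Qed.

Program Definition tens_act : algAct (tens V) :=
  @AlgAct (tens V) (fun g => tens_lift (tens_act_subproof g)) _ _.
Next Obligation.
move=> x; apply: (@tens_ext _ _ _ _ (ah_id (tens V))) => v.
by rewrite tens_liftE lr1 id_lfunE.
Qed.
Next Obligation.
move=> g h x; apply: (@tens_ext _ _ _ _ (ah_comp
  (tens_lift (tens_act_subproof g)) (tens_lift (tens_act_subproof h)))) => v.
by rewrite ah_compE !tens_liftE lrM comp_lfunE.
Qed.

Lemma tens_actE g v : tens_act g (tvec v) = tvec (rho g v).
Proof. exact: tens_liftE. Qed.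

End TensAct.

Section SymAct.
Context {V : vectType K} (rho : linrep V).

Fact sym_act_subproof g : linear_to (fun v : V => svec (rho g v)).
Proof. by move=> a u v; rewrite linearP svec_linear. Qed.

Definition sym_act_hom g : algHom (sym V) (sym V) :=
  sym_lift (sym_act_subproof g) (fun u v => svecC (rho g u) (rho g v)).

Program Definition sym_act : algAct (sym V) :=
  @AlgAct (sym V) sym_act_hom _ _.
Next Obligation.
move=> x; apply: (@sym_ext _ _ _ _ (ah_id (sym V))) => v.
by rewrite sym_liftE lr1 id_lfunE.
Qed.
Next Obligation.
move=> g h x; apply: (@sym_ext _ _ _ _
  (ah_comp (sym_act_hom g) (sym_act_hom h))) => v.
by rewrite ah_compE !sym_liftE lrM comp_lfunE.
Qed.

Lemma sym_actE g v : sym_act g (svec v) = svec (rho g v).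
Proof. exact: sym_liftE. Qed.

End SymAct.
End Representation.

(* C[G] |>< A, with elements sum_g a_g g and (a g) (b h) = a (g . b) (g h) *)
Section Smash.
Context {K : fieldType} {gT : finGroupType} {A : kalgType K}.

Definition smash (alpha : algAct gT A) : Type := {ffun gT -> A}.

Variable alpha : algAct gT A.
HB.instance Definition _ := GRing.Zmodule.on (smash alpha).

Definition smash_one : smash alpha := [ffun k => (k == 1%g)%:R].
Definition smash_mul (x y : smash alpha) : smash alpha :=
  [ffun k => \sum_g x g * alpha g (y (g^-1 * k)%g)].

Fact smash_mulA : associative smash_mul.
Proof.
move=> x y z; apply/ffunP => k; rewrite !ffunE.
under [RHS]eq_bigr => h _ do rewrite ffunE mulr_suml.
rewrite exchange_big /=; apply: eq_bigr => g _.
rewrite ffunE raddf_sum mulr_sumr [RHS](reindex_inj (mulgI g)) /=.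
apply: eq_bigr => h _.
by rewrite rmorphM /= mulKg aaM invMg !mulrA -mulgA.
Qed.

Fact smash_mul1 : left_id smash_one smash_mul.
Proof.
move=> x; apply/ffunP => k; rewrite ffunE (bigD1 1%g) //= ffunE eqxx mul1r.
rewrite aa1 invg1 mul1g big1 ?addr0 // => g /negPf g1.
by rewrite ffunE g1 mul0r.
Qed.

Fact smash_mulr1 : right_id smash_one smash_mul.
Proof.
move=> x; apply/ffunP => k; rewrite ffunE (bigD1 k) //= ffunE mulVg eqxx.
rewrite rmorph1 mulr1 big1 ?addr0 // => g gk.
by rewrite ffunE -eq_mulVg1 (negPf gk) raddf0 mulr0.
Qed.

Fact smash_mulDl : left_distributive smash_mul +%R.
Proof.
move=> x y z; apply/ffunP => k; rewrite !ffunE -big_split /=.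
by apply: eq_bigr => g _; rewrite ffunE mulrDl.
Qed.

Fact smash_mulDr : right_distributive smash_mul +%R.
Proof.
move=> x y z; apply/ffunP => k; rewrite !ffunE -big_split /=.
by apply: eq_bigr => g _; rewrite ffunE raddfD mulrDr.
Qed.

HB.instance Definition _ := GRing.Zmodule_isPzRing.Build (smash alpha)
  smash_mulA smash_mul1 smash_mulr1 smash_mulDl smash_mulDr.

Definition smash_in (a : A) : smash alpha :=
  [ffun k => if k == 1%g then a else 0].
Definition smash_grp (g : gT) : smash alpha := [ffun k => (k == g)%:R].

Fact smash_in_is_zmod_morphism : zmod_morphism smash_in.
Proof.
by move=> a b; apply/ffunP => k; rewrite !ffunE; case: eqP; rewrite ?subr0.
Qed.

Lemma smash_inMl a (x : smash alpha) : smash_in a * x = [ffun k => a * x k].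
Proof.
apply/ffunP => k; rewrite !ffunE (bigD1 1%g) //= ffunE eqxx aa1 invg1 mul1g.
by rewrite big1 ?addr0 // => g /negPf g1; rewrite ffunE g1 mul0r.
Qed.

Fact smash_in_is_monoid_morphism : monoid_morphism smash_in.
Proof.
split=> [|a b]; first by apply/ffunP => k; rewrite !ffunE; case: eqP.
rewrite smash_inMl; apply/ffunP => k; rewrite !ffunE.
by case: eqP; rewrite ?mulr0.
Qed.

Lemma smash_grpMl g (x : smash alpha) :
  smash_grp g * x = [ffun k => alpha g (x (g^-1 * k)%g)].
Proof.
apply/ffunP => k; rewrite !ffunE (bigD1 g) //= ffunE eqxx mul1r.
by rewrite big1 ?addr0 // => h /negPf hg; rewrite ffunE hg mul0r.
Qed.

Lemma smash_grp1 : smash_grp 1%g = 1. Proof. by []. Qed.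

Lemma smash_grpM g h : smash_grp (g * h)%g = smash_grp g * smash_grp h.
Proof.
rewrite smash_grpMl; apply/ffunP => k; rewrite !ffunE.
rewrite rmorph_nat; congr (nat_of_bool _)%:R.
by rewrite -[RHS](inj_eq (mulgI g)) mulKVg.
Qed.

Lemma smash_grp_in g a :
  smash_grp g * smash_in a = smash_in (alpha g a) * smash_grp g.
Proof.
rewrite smash_grpMl smash_inMl; apply/ffunP => k; rewrite !ffunE.
rewrite -eq_mulVg1 eq_sym; case: eqP; rewrite ?mulr1 ?mulr0 //.
by rewrite raddf0.
Qed.

Fact smash_scC (a : K) (x : smash alpha) :
  smash_in (sc a) * x = x * smash_in (sc a).
Proof.
rewrite smash_inMl; apply/ffunP => k; rewrite !ffunE (bigD1 k) //=.
rewrite ffunE mulVg eqxx ah_sc scC big1 ?addr0 // => g gk.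
by rewrite ffunE -eq_mulVg1 (negPf gk) raddf0 mulr0.
Qed.

Fact smash_sc_is_zmod_morphism : zmod_morphism (fun a : K => smash_in (sc a)).
Proof. by move=> a b; rewrite raddfB smash_in_is_zmod_morphism. Qed.
Fact smash_sc_is_monoid_morphism :
  monoid_morphism (fun a : K => smash_in (sc a)).
Proof.
by split=> [|a b]; rewrite ?rmorph1 ?rmorphM smash_in_is_monoid_morphism.
Qed.
HB.instance Definition _ := hasScalars.Build K (smash alpha)
  smash_sc_is_zmod_morphism smash_sc_is_monoid_morphism smash_scC.

Definition smash_inl : algHom A (smash alpha) :=
  @AlgHom K A (smash alpha) smash_in smash_in_is_zmod_morphism
    smash_in_is_monoid_morphism (fun=> erefl).

Lemma smash_sum (x : smash alpha) :
  x = \sum_g smash_inl (x g) * smash_grp g.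
Proof.
apply/ffunP => k; rewrite sum_ffunE (bigD1 k) //= smash_inMl !ffunE eqxx mulr1.
rewrite big1 ?addr0 // => g gk.
by rewrite smash_inMl !ffunE eq_sym (negPf gk) mulr0.
Qed.

Section Lift.
Variables (B : kalgType K) (phi : algHom A B) (u : gT -> B).
Hypothesis u1 : u 1%g = 1.
Hypothesis uM : forall g h, u (g * h)%g = u g * u h.
Hypothesis u_phi : forall g a, u g * phi a = phi (alpha g a) * u g.

Definition smash_eval (x : smash alpha) : B := \sum_g phi (x g) * u g.

Fact smash_eval_is_zmod_morphism : zmod_morphism smash_eval.
Proof.
move=> x y; rewrite /smash_eval -sumrB; apply: eq_bigr => g _.
by rewrite !ffunE raddfB mulrBl.
Qed.

Fact smash_eval_in a : smash_eval (smash_in a) = phi a.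
Proof.
rewrite /smash_eval (bigD1 1%g) //= ffunE eqxx u1 mulr1.
by rewrite big1 ?addr0 // => g /negPf g1; rewrite ffunE g1 raddf0 mul0r.
Qed.

Fact smash_eval_is_monoid_morphism : monoid_morphism smash_eval.
Proof.
split.
  rewrite -[LHS]/(smash_eval 1) -(smash_in_is_monoid_morphism).1.
  by rewrite smash_eval_in rmorph1.
move=> x y; rewrite /smash_eval mulr_suml.
under eq_bigr => k _ do rewrite ffunE raddf_sum mulr_suml /=.
rewrite exchange_big /=; apply: eq_bigr => g _.
rewrite mulr_sumr (reindex_inj (mulgI g)) /=; apply: eq_bigr => h _.
by rewrite mulKg rmorphM /= uM -!mulrA; congr (_ * _); rewrite !mulrA u_phi.
Qed.

Fact smash_eval_sc a : smash_eval (sc a) = sc a.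
Proof. by rewrite [LHS]smash_eval_in ah_sc. Qed.

Definition smash_lift : algHom (smash alpha) B :=
  AlgHom smash_eval_is_zmod_morphism smash_eval_is_monoid_morphism
    smash_eval_sc.

Lemma smash_lift_in a : smash_lift (smash_inl a) = phi a.
Proof. exact: smash_eval_in. Qed.

Lemma smash_lift_grp g : smash_lift (smash_grp g) = u g.
Proof.
rewrite /= /smash_eval (bigD1 g) //= ffunE eqxx rmorph1 mul1r.
by rewrite big1 ?addr0 // => h /negPf hg; rewrite ffunE hg raddf0 mul0r.
Qed.
End Lift.

End Smash.

Section Graded.
Context {K : comNzRingType} {A : kalgType K}.

Record filtration := Filtration {
  fil :> nat -> A -> Prop;
  fil0 : forall n, fil n 0;
  fil1 : fil 0%N 1;
  filD : forall n x y, fil n x -> fil n y -> fil n (x + y);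
  filZ : forall n a x, fil n x -> fil n (sc a * x);
  filM : forall m n x y, fil m x -> fil n y -> fil (m + n)%N (x * y);
  filS : forall n x, fil n x -> fil n.+1 x
}.

(* the least filtration in which x has degree at most n whenever D n x *)
Inductive fil_gen_pred (D : nat -> A -> Prop) : nat -> A -> Prop :=
| FilGen n x of D n x : fil_gen_pred D n x
| Fil0 n : fil_gen_pred D n 0
| Fil1 : fil_gen_pred D 0 1
| FilD n x y of fil_gen_pred D n x & fil_gen_pred D n y :
    fil_gen_pred D n (x + y)
| FilZ n a x of fil_gen_pred D n x : fil_gen_pred D n (sc a * x)
| FilM m n x y of fil_gen_pred D m x & fil_gen_pred D n y :
    fil_gen_pred D (m + n) (x * y)
| FilS n x of fil_gen_pred D n x : fil_gen_pred D n.+1 x.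

Definition fil_gen (D : nat -> A -> Prop) : filtration :=
  @Filtration (fil_gen_pred D) (@Fil0 D) (@Fil1 D) (@FilD D) (@FilZ D)
    (@FilM D) (@FilS D).

Variable F : filtration.

Fact filN n x : F n x -> F n (- x).
Proof. by move=> Fx; rewrite -mulN1r -(rmorph1 sc) -rmorphN; apply: filZ. Qed.

Fact fil_sum n (I : Type) (r : seq I) (P : pred I) (G : I -> A) :
  (forall i, P i -> F n (G i)) -> F n (\sum_(i <- r | P i) G i).
Proof. by move=> FG; elim/big_ind: _ => //; [apply: fil0|apply: filD]. Qed.

(* the algebra (+)_n F_n *)
Record rees := Rees {
  rees_coef :> nat -> A;
  rees_fin : exists N, forall n, (N <= n)%N -> rees_coef n = 0;
  rees_fil : forall n, F n (rees_coef n)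
}.

HB.instance Definition _ := gen_eqMixin rees.
HB.instance Definition _ := gen_choiceMixin rees.

Lemma reesP (p q : rees) : p =1 q -> p = q.
Proof.
case: p q => [p p1 p2] [q q1 q2] /= /funext pq; subst q.
by congr Rees; apply: Prop_irrelevance.
Qed.

Program Definition rees_zero : rees := @Rees (fun=> 0) _ _.
Next Obligation. by exists 0%N. Qed.
Next Obligation. by move=> n; apply: fil0. Qed.

Program Definition rees_opp (p : rees) : rees := @Rees (fun n => - p n) _ _.
Next Obligation.
by move=> p; have [N pN] := rees_fin p; exists N => n /pN ->; rewrite oppr0.
Qed.
Next Obligation. by move=> p n; apply/filN/rees_fil. Qed.

Program Definition rees_add (p q : rees) : rees :=
  @Rees (fun n => p n + q n) _ _.
Next Obligation.
move=> p q; have [N pN] := rees_fin p; have [M qM] := rees_fin q.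
exists (maxn N M) => n; rewrite geq_max => /andP[/pN -> /qM ->].
by rewrite addr0.
Qed.
Next Obligation. by move=> p q n; apply: filD; apply: rees_fil. Qed.

(* [rees_mono n x] is x placed in degree n *)
Program Definition rees_mono (n : nat) (x : A) (Fx : F n x) : rees :=
  @Rees (fun m => if m == n then x else 0) _ _.
Next Obligation.
move=> n x _; exists n.+1 => m; case: eqP => // ->.
by rewrite ltnn.
Qed.
Next Obligation.
by move=> n x Fx m /=; case: eqP => [->//|_]; apply: fil0.
Qed.

Program Definition rees_mul (p q : rees) : rees :=
  @Rees (fun n => \sum_(i < n.+1) p i * q (n - i)%N) _ _.
Next Obligation.
move=> p q; have [N pN] := rees_fin p; have [M qM] := rees_fin q.
exists (N + M)%N => n NMn; rewrite big1 // => i _.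
have [/pN -> | iN] := leqP N i; first by rewrite mul0r.
rewrite qM ?mulr0 // leq_subRL; last by rewrite -ltnS.
by apply: leq_trans NMn; rewrite leq_add2r ltnW.
Qed.
Next Obligation.
move=> p q n; apply: fil_sum => i _.
have {1}-> : n = (i + (n - i))%N by rewrite subnKC // -ltnS.
by apply: filM; apply: rees_fil.
Qed.

Definition rees_one : rees := rees_mono (fil1 F).

Fact rees_addA : associative rees_add.
Proof. by move=> p q r; apply: reesP => n /=; rewrite addrA. Qed.
Fact rees_addC : commutative rees_add.
Proof. by move=> p q; apply: reesP => n /=; rewrite addrC. Qed.
Fact rees_add0 : left_id rees_zero rees_add.
Proof. by move=> p; apply: reesP => n /=; rewrite add0r. Qed.
Fact rees_addN : left_inverse rees_zero rees_opp rees_add.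
Proof. by move=> p; apply: reesP => n /=; rewrite addNr. Qed.
HB.instance Definition _ :=
  GRing.isZmodule.Build rees rees_addA rees_addC rees_add0 rees_addN.

Fact rees_mul_rev (p q : rees) n :
  rees_mul p q n = \sum_(i < n.+1) p (n - i)%N * q i.
Proof.
rewrite /= (reindex_inj rev_ord_inj) /=.
by apply: eq_bigr => j _; rewrite (sub_ordK j).
Qed.

Fact rees_mulA : associative rees_mul.
Proof.
move=> p q r; apply: reesP => i; rewrite [RHS]rees_mul_rev /=.
pose coef3 (j k : nat) := p j * (q (i - j - k)%N * r k).
transitivity (\sum_(j < i.+1) \sum_(k < i.+1 | (k <= i - j)%N) coef3 j k).
  apply: eq_bigr => /= j _; rewrite -[X in _ * X]/(rees_mul q r (i - j)%N).
  rewrite rees_mul_rev big_distrr /=.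
  by rewrite (big_ord_narrow_leq (leq_subr _ _)).
rewrite (exchange_big_dep predT) //=; apply: eq_bigr => k _.
transitivity (\sum_(j < i.+1 | (j <= i - k)%N) coef3 j k).
  apply: eq_bigl => j; rewrite -ltnS -(ltnS j) -!subSn ?leq_ord //.
  by rewrite -subn_gt0 -(subn_gt0 j) -!subnDA addnC.
rewrite (big_ord_narrow_leq (leq_subr _ _)) big_distrl /=.
by apply: eq_bigr => j _; rewrite /coef3 -!subnDA addnC mulrA.
Qed.

Fact rees_mul1 : left_id rees_one rees_mul.
Proof.
move=> p; apply: reesP => n /=; rewrite big_ord_recl /= mul1r subn0.
by rewrite big1 ?addr0 // => i _; rewrite mul0r.
Qed.

Fact rees_mulr1 : right_id rees_one rees_mul.
Proof.
move=> p; apply: reesP => n; rewrite rees_mul_rev big_ord_recl /= mulr1 subn0.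
by rewrite big1 ?addr0 // => i _; rewrite mulr0.
Qed.

Fact rees_mulDl : left_distributive rees_mul +%R.
Proof.
move=> p q r; apply: reesP => n /=; rewrite -big_split /=.
by apply: eq_bigr => i _; rewrite mulrDl.
Qed.

Fact rees_mulDr : right_distributive rees_mul +%R.
Proof.
move=> p q r; apply: reesP => n /=; rewrite -big_split /=.
by apply: eq_bigr => i _; rewrite mulrDr.
Qed.

HB.instance Definition _ := GRing.Zmodule_isPzRing.Build rees
  rees_mulA rees_mul1 rees_mulr1 rees_mulDl rees_mulDr.

Fact fil_sc a : F 0%N (sc a).
Proof. by rewrite -[sc a]mulr1; apply/filZ/fil1. Qed.

Definition rees_sc (a : K) : rees := rees_mono (fil_sc a).

Fact rees_sc_is_zmod_morphism : zmod_morphism rees_sc.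
Proof.
move=> a b; apply: reesP => n /=.
by case: eqP => _; rewrite ?subr0 // raddfB.
Qed.

Fact rees_scMl a (p : rees) n : (rees_sc a * p) n = sc a * p n.
Proof.
rewrite /= big_ord_recl /= subn0 big1 ?addr0 // => i _.
by rewrite mul0r.
Qed.

Fact rees_sc_is_monoid_morphism : monoid_morphism rees_sc.
Proof.
split=> [|a b]; first by apply: reesP => n /=; rewrite rmorph1.
apply: reesP => n; rewrite rees_scMl /= rmorphM.
by case: eqP => _; rewrite ?mulr0.
Qed.

Fact rees_scC a (p : rees) : rees_sc a * p = p * rees_sc a.
Proof.
apply: reesP => n; rewrite rees_scMl [RHS]rees_mul_rev big_ord_recl /= subn0.
by rewrite big1 ?addr0 ?scC // => i _; rewrite mulr0.
Qed.

HB.instance Definition _ := hasScalars.Build K rees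
  rees_sc_is_zmod_morphism rees_sc_is_monoid_morphism rees_scC.

Definition fil_pred (n : nat) (x : A) : Prop :=
  if n is m.+1 then F m x else x = 0.

Fact fil_pred_fil n x : fil_pred n x -> F n x.
Proof. by case: n => [->|n Fx]; [apply: fil0|apply: filS]. Qed.

Fact fil_predMl m n x y : F m x -> fil_pred n y -> fil_pred (m + n) (x * y).
Proof.
case: n => [|n] Fx; last by rewrite addnS; apply: filM.
move=> -> /=; rewrite mulr0 addn0.
by case: m Fx => //= m _; apply: fil0.
Qed.

Fact fil_predMr m n x y : fil_pred m x -> F n y -> fil_pred (m + n) (x * y).
Proof.
case: m => [|m] Fx Fy; last by rewrite addSn; apply: filM.
rewrite Fx mul0r add0n.
by case: n Fy => //= n _; apply: fil0.
Qed.

Fact fil_pred0 n : fil_pred n 0.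
Proof. by case: n => //= n; apply: fil0. Qed.

Fact fil_predD n x y : fil_pred n x -> fil_pred n y -> fil_pred n (x + y).
Proof. by case: n => [-> ->|n]; [rewrite /= addr0|apply: filD]. Qed.

Fact fil_pred_sum n (I : Type) (r : seq I) (P : pred I) (G : I -> A) :
  (forall i, P i -> fil_pred n (G i)) -> fil_pred n (\sum_(i <- r | P i) G i).
Proof.
by move=> FG; elim/big_ind: _ => //; [apply: fil_pred0|apply: fil_predD].
Qed.

(* the ideal (+)_n F_(n-1) of (+)_n F_n, where F_(-1) = 0 *)
Program Definition rees_lower : ideal rees :=
  @Ideal K rees (fun p => forall n, fil_pred n (p n)) _ _ _ _.
Next Obligation. by move=> n; apply: fil_pred0. Qed.
Next Obligation. by move=> p q Fp Fq n; apply: fil_predD. Qed.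
Next Obligation.
move=> p q Fq n; apply: fil_pred_sum => i _.
have {1}-> : n = (i + (n - i))%N by rewrite subnKC // -ltnS.
by apply: fil_predMl => //; apply: rees_fil.
Qed.
Next Obligation.
move=> p q Fq n; apply: fil_pred_sum => i _.
have {1}-> : n = (i + (n - i))%N by rewrite subnKC // -ltnS.
by apply: fil_predMr => //; apply: rees_fil.
Qed.

(* gr A = (+)_n F_n / F_(n-1) *)
Definition gr : kalgType K := quot rees_lower.

(* the class of x : F_n in F_n / F_(n-1) *)
Definition gr_class (n : nat) (x : A) (Fx : F n x) : gr :=
  quot_pi rees_lower (rees_mono Fx).

Lemma gr_class_eq0 n x (Fx : F n x) : gr_class Fx = 0 <-> fil_pred n x.
Proof.
rewrite quot_pi_eq0; split=> [/(_ n) /=|Fx' m /=]; first by rewrite eqxx.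
by case: eqP => [->//|_]; apply: fil_pred0.
Qed.

Lemma gr_class_irr n x y (Fx : F n x) (Fy : F n y) :
  x = y -> gr_class Fx = gr_class Fy.
Proof. by move=> xy; congr (quot_pi _ _); apply: reesP => m /=; rewrite xy. Qed.

Lemma gr_classD n x y (Fx : F n x) (Fy : F n y) :
  gr_class (filD Fx Fy) = gr_class Fx + gr_class Fy.
Proof.
rewrite /gr_class -raddfD; congr (quot_pi _ _); apply: reesP => m /=.
by case: eqP; rewrite ?addr0.
Qed.

Lemma gr_classN n x (Fx : F n x) : gr_class (filN Fx) = - gr_class Fx.
Proof.
rewrite /gr_class -raddfN; congr (quot_pi _ _); apply: reesP => m /=.
by case: eqP; rewrite ?oppr0.
Qed.

Lemma gr_classM m n x y (Fx : F m x) (Fy : F n y) :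
  gr_class (filM Fx Fy) = gr_class Fx * gr_class Fy.
Proof.
rewrite /gr_class -(rmorphM (quot_pi rees_lower)); congr (quot_pi _ _).
apply: reesP => k /=; case: eqP => [->|kmn].
  have mk : (m < (m + n).+1)%N by rewrite ltnS leq_addr.
  rewrite (bigD1 (Ordinal mk)) //= eqxx addKn eqxx big1 ?addr0 // => i im.
  by have /negPf -> : (i : nat) != m by []; rewrite mul0r.
rewrite big1 // => i _; case: eqP => [im|_]; last by rewrite mul0r.
case: eqP => [kin|_]; last by rewrite mulr0.
by case: kmn; rewrite -kin -im subnKC // -ltnS.
Qed.

Lemma gr_classZ n a x (Fx : F n x) :
  gr_class (filZ a Fx) = sc a * gr_class Fx.
Proof.
rewrite /gr_class -(ah_sc (quot_pi rees_lower)).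
rewrite -(rmorphM (quot_pi rees_lower)); congr (quot_pi _ _).
apply: reesP => k; rewrite [RHS]rees_scMl /=.
by case: eqP; rewrite ?mulr0.
Qed.

Lemma gr_class1 : gr_class (fil1 F) = 1. Proof. by []. Qed.

End Graded.
Arguments filtration {K} A.

(* C[G], as a vector space of functions on G *)
Definition grpalg (K : fieldType) (gT : finGroupType) : Type :=
  {ffun gT -> K^o}.
HB.instance Definition _ (K : fieldType) (gT : finGroupType) :=
  GRing.Lmodule.on (grpalg K gT).

Definition gdelta (K : fieldType) (gT : finGroupType) (g : gT) : grpalg K gT :=
  [ffun h => (h == g)%:R].

(* g a g^-1: the coefficient at h is the coefficient of a at g^-1 h g = h ^ g *)
Definition gconj (K : fieldType) (gT : finGroupType) (g : gT)
  (a : grpalg K gT) : grpalg K gT := [ffun h => a (h ^ g)%g].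

Definition smash_grpalg (K : fieldType) (gT : finGroupType) (A : kalgType K)
  (alpha : algAct gT A) (a : grpalg K gT) : smash alpha :=
  \sum_g sc (a g : K) * smash_grp alpha g.

Section Hkappa.
Context {K : fieldType} {V : vectType K} {gT : finGroupType}.
Variables (rho : linrep gT V) (kappa : V -> V -> grpalg K gT).

Local Notation GT := (smash (tens_act rho)).
Local Notation GS := (smash (sym_act rho)).

Variant Hk_rel : GT -> Prop := HkRel x y :
  Hk_rel (smash_inl (tens_act rho) (tvec x) * smash_inl (tens_act rho) (tvec y)
        - smash_inl (tens_act rho) (tvec y) * smash_inl (tens_act rho) (tvec x)
        - smash_grpalg (tens_act rho) (kappa x y)).

Definition Hk : kalgType K := quot (ideal_gen Hk_rel).

Definition Hk_pi : algHom GT Hk := quot_pi (ideal_gen Hk_rel).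
Definition Hk_vec (v : V) : Hk := Hk_pi (smash_inl (tens_act rho) (tvec v)).
Definition Hk_grp (g : gT) : Hk := Hk_pi (smash_grp (tens_act rho) g).

Variant Hk_deg : nat -> Hk -> Prop :=
| HkDegG g : Hk_deg 0 (Hk_grp g)
| HkDegV v : Hk_deg 1 (Hk_vec v).

Definition Hk_fil : filtration Hk := fil_gen Hk_deg.

Lemma Hk_vec_linear : linear_to Hk_vec.
Proof. exact/linear_to_comp/linear_to_comp/tvec_linear. Qed.

Lemma Hk_grp1 : Hk_grp 1%g = 1. Proof. exact: rmorph1 Hk_pi. Qed.

Lemma Hk_grpM g h : Hk_grp (g * h)%g = Hk_grp g * Hk_grp h.
Proof. by rewrite /Hk_grp smash_grpM (rmorphM Hk_pi). Qed.

Lemma Hk_grp_vec g v : Hk_grp g * Hk_vec v = Hk_vec (rho g v) * Hk_grp g.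
Proof.
rewrite /Hk_grp /Hk_vec -tens_actE.
rewrite -(rmorphM Hk_pi) -(rmorphM Hk_pi).
exact/(congr1 Hk_pi)/smash_grp_in.
Qed.

Lemma Hk_comm x y :
  Hk_vec x * Hk_vec y - Hk_vec y * Hk_vec x =
  \sum_g sc (kappa x y g : K) * Hk_grp g.
Proof.
transitivity (Hk_pi (smash_grpalg (tens_act rho) (kappa x y))).
  rewrite /Hk_vec -(rmorphM Hk_pi) -(rmorphM Hk_pi) -(raddfB Hk_pi).
  by apply/qpiP/mem_ideal_gen; apply: HkRel.
rewrite /smash_grpalg raddf_sum /=; apply: eq_bigr => g _.
by rewrite (rmorphM Hk_pi); congr (_ * _); apply: ah_sc.
Qed.

Lemma Hk_fil_grp g : Hk_fil 0%N (Hk_grp g).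
Proof. exact/FilGen/HkDegG. Qed.

Lemma Hk_fil_vec v : Hk_fil 1%N (Hk_vec v).
Proof. exact/FilGen/HkDegV. Qed.

Definition gr_vec (v : V) : gr Hk_fil := gr_class (Hk_fil_vec v).
Definition gr_grp (g : gT) : gr Hk_fil := gr_class (Hk_fil_grp g).

Lemma gr_vec_linear : linear_to gr_vec.
Proof.
move=> a u v; rewrite /gr_vec -gr_classZ -gr_classD.
by apply: gr_class_irr; apply: Hk_vec_linear.
Qed.

Lemma gr_vecC u v : gr_vec u * gr_vec v = gr_vec v * gr_vec u.
Proof.
apply/eqP; rewrite -subr_eq0 -!gr_classM -gr_classN -gr_classD.
apply/eqP/gr_class_eq0; rewrite Hk_comm.
apply: (@filS _ _ Hk_fil 0%N); apply: fil_sum => g _.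
exact/filZ/Hk_fil_grp.
Qed.

Lemma gr_grp1 : gr_grp 1%g = 1.
Proof. by rewrite -gr_class1; apply/gr_class_irr/Hk_grp1. Qed.

Lemma gr_grpM g h : gr_grp (g * h)%g = gr_grp g * gr_grp h.
Proof. by rewrite -gr_classM; apply/gr_class_irr/Hk_grpM. Qed.

Lemma gr_grp_vec g v : gr_grp g * gr_vec v = gr_vec (rho g v) * gr_grp g.
Proof. by rewrite -!gr_classM; apply/gr_class_irr/Hk_grp_vec. Qed.

Definition xi_sym : algHom (sym V) (gr Hk_fil) :=
  sym_lift gr_vec_linear gr_vecC.

Lemma xi_sym_grp g a :
  gr_grp g * xi_sym a = xi_sym (sym_act rho g a) * gr_grp g.
Proof.
apply: sym_intertwine => v.
by rewrite sym_actE !sym_liftE gr_grp_vec.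
Qed.

(* the natural homomorphism C[G] |>< SV -> gr H_kappa, g |-> [g], v |-> [v] *)
Definition xi : algHom GS (gr Hk_fil) :=
  smash_lift gr_grp1 gr_grpM xi_sym_grp.

Lemma xi_vec v : xi (smash_inl (sym_act rho) (svec v)) = gr_vec v.
Proof. by rewrite smash_lift_in sym_liftE. Qed.

Lemma xi_grp g : xi (smash_grp (sym_act rho) g) = gr_grp g.
Proof. exact: smash_lift_grp. Qed.

End Hkappa.

Section SymplecticReflections.
Context {K : fieldType} {V : vectType K} {gT : finGroupType}.
Variables (rho : linrep gT V) (omega : {skew_symmetric V}).

Definition im1B (g : gT) : {vspace V} := limg (\1 - rho g)%VF.
Definition ker1B (g : gT) : {vspace V} := lker (\1 - rho g)%VF.

Definition symp_refl (g : gT) : bool := \dim (im1B g) == 2.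

(* [daddv_pi U W] is the projection to U along W *)
Definition omega_refl (s : gT) (x y : V) : K :=
  omega (daddv_pi (im1B s) (ker1B s) x) (daddv_pi (im1B s) (ker1B s) y).

Definition rep_invariant (beta : V -> V -> K) : Prop :=
  forall g x y, beta (rho g x) (rho g y) = beta x y.

End SymplecticReflections.

(* Main.v *)
Require Import Defs.
From HB Require Import structures.
From mathcomp Require Import all_fingroup.
From mathcomp Require Import all_boot all_order all_algebra.
From mathcomp Require Import cyclic boolp ring.
From mathcomp.multinomials Require Import monalg.
From mathcomp Require Import finmap reals complex.

(* The Jacobi identity in H_kappa for x, y, z in V, written in degree one of gr
   H_kappa, says that for every g in G the cyclic sum of kappa_g(x, y) (z -
   g z) vanishes. If xi is injective this already holds in V. When 1 - g has
   rank at least 3, z can be chosen with (1 - g) z outside the span of (1 -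
   g) x and (1 - g) y, so kappa_g = 0; when the rank is 2, the same argument
   shows that kappa_g factors through the projection to Im(1 - g), a plane,
   on which it is a multiple of omega; rank 1 is impossible because Im(1 -
   g) is a symplectic subspace; and kappa_1 is an invariant form.

   Conversely, the Jacobi identity holds for these kappa because an
   alternating trilinear map on a plane is zero, and it implies the PBW
   property by Bergman's diamond argument. In a basis of V, a linear normal
   form map N : T(V) -> C[G] |>< SV with N(a [x, y] b) = N(a kappa(x, y) b)
   is constructed by recursion on the number of times kappa is used. At each
   step one has to find a function on words with prescribed differences
   under adjacent transpositions, and this is possible when the differences
   satisfy the relations of the symmetric group, which here amount to
   equivariance (commuting transpositions) and the Jacobi identity (braid
   relation). N induces a map H_kappa -> C[G] |>< SV that sends a word to
   its class in SV up to terms of lower degree, whence xi is injective. *)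

Set Implicit Arguments.
Unset Strict Implicit.
Unset Printing Implicit Defensive.

Import GRing.Theory.
Local Open Scope ring_scope.

(** * Sorting words *)

Section SortingCost.
Context {n : nat} {M : zmodType}.
Local Notation I := 'I_n.
Implicit Types (a b s w : seq I) (x y z : I).

Fixpoint insert_ord x s : seq I :=
  if s is y :: s' then if (x <= y)%N then x :: s else y :: insert_ord x s'
  else [:: x].

Definition sort_ord : seq I -> seq I := foldr insert_ord [::].

(** Makes [sort_ord] insensitive to the order of the letters, so that two words differing by a swap
    share one sorted form. *)
Lemma insert_ordC x y s :
  insert_ord x (insert_ord y s) = insert_ord y (insert_ord x s).
Proof.
wlog le_yx : x y / (y <= x)%N.
  by move=> wl; case/orP: (leq_total x y) => /wl ->.
have [->//|neq_xy] := eqVneq x y.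
have lt_yx : (y < x)%N by rewrite ltn_neqAle le_yx eq_sym neq_xy.
elim: s => [|z s IHs] /=; first by rewrite leqNgt lt_yx /= le_yx.
have [le_yz|lt_zy] := leqP y z.
  rewrite /= leqNgt lt_yx /=.
  by case: (leqP x z) => _ /=; rewrite ?le_yx ?le_yz.
have lt_zx := ltn_trans lt_zy lt_yx.
by rewrite /= leqNgt lt_zx /= (leqNgt y z) lt_zy /= IHs.
Qed.

Lemma sort_ord_swap a x y b :
  sort_ord (a ++ x :: y :: b) = sort_ord (a ++ y :: x :: b).
Proof. by elim: a => [|z a IHa] /=; [apply: insert_ordC|rewrite IHa]. Qed.

(* [D a x y b] is the prescribed value of [h (a x y b) - h (a y x b)].  When [D]
   respects the relations of the symmetric group (hypotheses below), such a
   function [h] exists: the total cost of insertion sort. *)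
Variable D : seq I -> I -> I -> seq I -> M.

(** [a] is the prefix standing to the left. The letter [x] moves right past smaller letters, and
    each swap adds the value of [D] at the word where it takes place. *)
Fixpoint insert_cost a x s : M :=
  if s is y :: s' then
    if (x <= y)%N then 0 else D a x y s' + insert_cost (rcons a y) x s'
  else 0.

Fixpoint sort_cost a w : M :=
  if w is x :: w' then
    sort_cost (rcons a x) w' + insert_cost a x (sort_ord w')
  else 0.

Hypothesis D_same : forall a x b, D a x x b = 0.
Hypothesis D_anti : forall a x y b, D a x y b = - D a y x b.
(** Two disjoint swaps give the same total in either order. *)
Hypothesis D_far : forall a x y b z t c,
  D a x y (b ++ z :: t :: c) - D a x y (b ++ t :: z :: c) =
  D (a ++ x :: y :: b) z t c - D (a ++ y :: x :: b) z t c.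
(** The two sides are the totals along the two ways of turning [x y z] into [z y x] by three swaps
    of neighbours. *)
Hypothesis D_braid : forall a x y z c,
  D a x y (z :: c) + D (rcons a y) x z c + D a y z (x :: c) =
  D (rcons a x) y z c + D a x z (y :: c) + D (rcons a z) x y c.

(** Every swap in the insertion of [z] is disjoint from the swap of [x] and [y] in the prefix; the
    differences given by [D_far] telescope. *)
Lemma insert_cost_far a x y b z s :
  insert_cost (a ++ x :: y :: b) z s - insert_cost (a ++ y :: x :: b) z s =
  D a x y (b ++ z :: s) - D a x y (b ++ insert_ord z s).
Proof.
elim: s b => [|t s IHs] b /=; first by rewrite !subrr.
case: (leqP z t) => _; first by rewrite !subrr.
rewrite opprD addrACA -!cats1 -!catA /= !cats1 IHs -D_far.
by rewrite -!cats1 -!catA /= subrKA.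
Qed.

Lemma sort_cost_far a x y b w :
  sort_cost (a ++ x :: y :: b) w - sort_cost (a ++ y :: x :: b) w =
  D a x y (b ++ w) - D a x y (b ++ sort_ord w).
Proof.
elim: w b => [|z w IHw] b /=; first by rewrite !subrr.
rewrite opprD addrACA insert_cost_far -!cats1 -!catA /= !cats1 IHw.
by rewrite -!cats1 -!catA /= subrKA.
Qed.

(** Induction on [s]. When both letters pass the first letter [z] of [s], [insert_cost_far] brings
    [z] to the front of the prefix, the induction hypothesis applies after [rcons a z], and the
    braid relation for [x y z] closes the gap. *)
Lemma insert_cost_swap a x y s :
  insert_cost (rcons a x) y s + insert_cost a x (insert_ord y s) =
  D a x y s + (insert_cost (rcons a y) x s + insert_cost a y (insert_ord x s)).
Proof.
wlog le_yx : x y / (y <= x)%N.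
  move=> wl; case/orP: (leq_total x y) => /wl //->.
  by rewrite addrA D_anti addNr add0r.
have [->|neq_xy] := eqVneq x y; first by rewrite D_same add0r.
have lt_yx : (y < x)%N by rewrite ltn_neqAle le_yx eq_sym neq_xy.
elim: s a => [|z s IHs] a /=.
  by rewrite leqNgt lt_yx le_yx /= !addr0 add0r.
have [le_yz|lt_zy] := leqP y z.
  rewrite add0r /= leqNgt lt_yx /=; congr (_ + _).
  by case: (leqP x z) => _; rewrite /= ?le_yx ?le_yz addr0.
have lt_zx := ltn_trans lt_zy lt_yx.
rewrite (leqNgt x z) lt_zx /= (leqNgt x z) lt_zx (leqNgt y z) lt_zy /=.
have far u v : insert_cost (rcons (rcons a u) z) v s =
    D a u z (v :: s) - D a u z (insert_ord v s) +
    insert_cost (rcons (rcons a z) u) v s.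
  apply/eqP; rewrite -subr_eq; apply/eqP.
  by rewrite -!cats1 -!catA /= (insert_cost_far a u z [::] v s).
rewrite (far x y) (far y x).
have := D_braid a x y z s; have := IHs (rcons a z).
set p := insert_cost _ y s; set q := insert_cost _ x (insert_ord y s).
set p' := insert_cost _ x s; set q' := insert_cost _ y (insert_ord x s).
move=> pq br.
have E1 : D (rcons a x) y z s + (D a x z (y ::
  s) - D a x z (insert_ord y s) + p)
    + (D a x z (insert_ord y s) + q) =
    D (rcons a x) y z s + D a x z (y :: s) + (p + q).
  by rewrite -!addrA; congr (_ + (_ + _)); rewrite (addrCA p) addKr.
rewrite E1 pq addrA -br -!addrA; congr (_ + (_ + (_ + _))).
by rewrite addrCA addKr.
Qed.

(** The letters of [p] are inserted into tails with the same sorted form, so only the swapped pair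
    matters: [sort_cost_far] compares the sorting of [q] behind the two prefixes, and
    [insert_cost_swap] the last two insertions. *)
Lemma sort_cost_swap a p x y q :
  sort_cost a (p ++ x :: y :: q) - sort_cost a (p ++ y :: x :: q) =
  D (a ++ p) x y q.
Proof.
elim: p a => [|z p IHp] a /=; last first.
  by rewrite sort_ord_swap opprD addrACA subrr addr0 IHp cat_rcons.
have far : sort_cost (rcons (rcons a x) y) q =
    D a x y q - D a x y (sort_ord q) + sort_cost (rcons (rcons a y) x) q.
  apply/eqP; rewrite -subr_eq; apply/eqP.
  by rewrite -!cats1 -!catA /= (sort_cost_far a x y [::] q).
rewrite cats0 -[X in X - _]addrA -[X in _ - X]addrA insert_cost_swap far.
by rewrite addrACA subrK addrK.
Qed.

(** All swaps take place in words of one length, so a property closed under sums need only be known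
    for [D] at that length. *)
Lemma insert_cost_ind (P : M -> Prop) a x s :
  P 0 -> (forall u v, P u -> P v -> P (u + v)) ->
  (forall b y z c, size b + (size c).+2 = size a + (size s).+1 ->
    P (D b y z c))%N ->
  P (insert_cost a x s).
Proof.
move=> P0 PD; elim: s a => [|y s IHs] a Pw //=; case: ifP => _ //.
apply: (PD); first exact: Pw.
by apply: IHs => b u v c bc; apply: Pw; rewrite bc size_rcons addSnnS.
Qed.

Lemma size_sort_ord w : size (sort_ord w) = size w.
Proof.
have size_insert x s : size (insert_ord x s) = (size s).+1.
  by elim: s => //= y s IHs; case: ifP => //= _; rewrite IHs.
by elim: w => //= x w IHw; rewrite size_insert IHw.
Qed.

Lemma sort_cost_ind (P : M -> Prop) a w :
  P 0 -> (forall u v, P u -> P v -> P (u + v)) ->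
  (forall b x y c, size b + (size c).+2 = size a + size w -> P (D b x y c))%N ->
  P (sort_cost a w).
Proof.
move=> P0 PD; elim: w a => [|y w IHw] a Pw //=; apply: (PD).
  by apply: IHw => b u v c bc; apply: Pw; rewrite bc size_rcons addSnnS.
apply: insert_cost_ind => // b u v c; rewrite size_sort_ord; apply: Pw.
Qed.

End SortingCost.

(** * Linear maps and the free algebra *)

Section KLinear.
Context {K : comNzRingType}.
Implicit Types A B C : kalgType K.

(** The scalars of a [kalgType] act through [sc], and linearity is expressed accordingly. *)
Definition klinear A B (f : A -> B) : Prop :=
  forall a x y, f (sc a * x + y) = sc a * f x + f y.

Lemma mulr_scA A (a : K) (x y : A) : x * (sc a * y) = sc a * (x * y).
Proof. by rewrite mulrA -scC -mulrA. Qed.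

Lemma scN1r A (x : A) : sc (-1 : K) * x = - x.
Proof. by rewrite raddfN /= rmorph1 mulN1r. Qed.

Lemma scM_comm A (x : A) (a b : K) :
  (sc a * x) * (sc b * x) = (sc b * x) * (sc a * x).
Proof.
by rewrite mulr_scA -mulrA [RHS]mulr_scA -mulrA !(mulrA (sc _) (sc _)) scC.
Qed.

Section Theory.
Variables (A B : kalgType K) (f : A -> B) (lf : klinear f).

Lemma klinear0 : f 0 = 0.
Proof. by have := lf (-1) 0 0; rewrite mulr0 addr0 scN1r addNr. Qed.

Lemma klinearD x y : f (x + y) = f x + f y.
Proof. by have := lf 1 x y; rewrite !rmorph1 !mul1r. Qed.

Lemma klinearZ a x : f (sc a * x) = sc a * f x.
Proof. by rewrite -[sc a * x]addr0 lf klinear0 addr0. Qed.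

Lemma klinearB x y : f (x - y) = f x - f y.
Proof. by rewrite -scN1r addrC lf scN1r addrC. Qed.

Lemma klinearN x : f (- x) = - f x.
Proof. by rewrite -sub0r klinearB klinear0 sub0r. Qed.

Lemma klinear_sum (J : Type) (r : seq J) (P : pred J) (F : J -> A) :
  f (\sum_(i <- r | P i) F i) = \sum_(i <- r | P i) f (F i).
Proof. exact: (big_morph f klinearD klinear0). Qed.
End Theory.

Lemma klinear_hom A B (f : algHom A B) : klinear f.
Proof. by move=> a x y; rewrite ahD ahM ah_sc. Qed.

Lemma klinear_comp A B C (f : B -> C) (g : A -> B) :
  klinear f -> klinear g -> klinear (fun x => f (g x)).
Proof. by move=> lf lg a x y; rewrite lg lf. Qed.

Lemma klinear_mull A B (c : B) (f : A -> B) : klinear f -> klinear (fun x =>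
  c * f x).
Proof. by move=> lf a x y; rewrite lf mulrDr mulr_scA. Qed.

Lemma klinear_mulr A B (c : B) (f : A -> B) : klinear f -> klinear (fun x =>
  f x * c).
Proof. by move=> lf a x y; rewrite lf mulrDl mulrA. Qed.

Lemma klinear_bigsum A B (J : Type) (r : seq J) (P : pred J) (F : J -> A -> B) :
  (forall i, P i -> klinear (F i)) -> klinear (fun x =>
    \sum_(i <- r | P i) F i x).
Proof.
move=> lF a x y; rewrite mulr_sumr -big_split /=.
by apply: eq_bigr => i Pi; rewrite lF.
Qed.

Section LinearTo.
Variables (V : lmodType K) (A : kalgType K) (f : V -> A) (lf : linear_to f).

Lemma linear_to0 : f 0 = 0.
Proof. by have := lf (-1) 0 0; rewrite scaler0 addr0 scN1r addNr. Qed.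

Lemma linear_toD x y : f (x + y) = f x + f y.
Proof. by have := lf 1 x y; rewrite scale1r rmorph1 mul1r. Qed.

Lemma linear_toZ a x : f (a *: x) = sc a * f x.
Proof. by rewrite -[a *: x]addr0 lf linear_to0 addr0. Qed.

Lemma linear_to_sum (J : Type) (r : seq J) (P : pred J) (F : J -> V) :
  f (\sum_(i <- r | P i) F i) = \sum_(i <- r | P i) f (F i).
Proof. exact: (big_morph f linear_toD linear_to0). Qed.
End LinearTo.

Lemma linear_to_bigsum (V : lmodType K) (A : kalgType K) (J : Type)
    (r : seq J) (F : J -> V -> A) :
  (forall i, linear_to (F i)) -> linear_to (fun v => \sum_(i <- r) F i v).
Proof.
move=> lF a u v; rewrite mulr_sumr -big_split /=.
by apply: eq_bigr => i _; rewrite lF.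
Qed.

Lemma linear_to_scalar (V : lmodType K) (A : kalgType K) (c : V -> K) (x : A) :
  (forall a u v, c (a *: u + v) = a * c u + c v) ->
  linear_to (fun v => sc (c v) * x).
Proof. by move=> lc a u v; rewrite lc raddfD /= rmorphM /= mulrDl mulrA. Qed.

End KLinear.

Section LinearToBasis.
Context {K : fieldType} {V : vectType K} {n : nat} {b : n.-tuple V}.
Hypothesis bP : basis_of fullv b.

Lemma linear_to_ext (A : kalgType K) (f g : V -> A) :
  linear_to f -> linear_to g -> (forall i : 'I_n, f b`_i = g b`_i) -> f =1 g.
Proof.
move=> lf lg fg v; rewrite (coord_basis bP (memvf v)).
rewrite (linear_to_sum lf) (linear_to_sum lg); apply: eq_bigr => i _.
by rewrite (linear_toZ lf) (linear_toZ lg) fg.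
Qed.

End LinearToBasis.


(* Any such structure is the free algebra on [I], given by its basis of words
   and by the linear extension of maps defined on words. *)
Record word_algebra (K : comNzRingType) (I : Type) := WordAlgebra {
  wa_alg :> kalgType K;
  word : seq I -> wa_alg;
  word0 : word [::] = 1;
  wordM : forall a b, word (a ++ b) = word a * word b;
  word_span : forall x : wa_alg, exists s : seq (K * seq I),
    x = \sum_(p <- s) sc p.1 * word p.2;
  wext : forall B : kalgType K, (seq I -> B) -> wa_alg -> B;
  klinear_wext : forall (B : kalgType K) (f : seq I -> B), klinear (wext f);
  wext_word : forall (B : kalgType K) (f : seq I -> B) w, wext f (word w) = f w
}.

Section FreeAlgebra.
Context {K : fieldType} (I : choiceType).
Local Notation fa := {malg K[{fmonom I}]}.

Definition malg_ext (B : kalgType K) (f : seq I -> B) (x : fa) : B :=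
  \sum_(m <- msupp x) sc x@_m * f m.

Let malg_extw (B : kalgType K) (f : seq I -> B) (d : {fset {fmonom I}}) x :
  (msupp x `<=` d)%fset -> malg_ext f x = \sum_(m <- d) sc x@_m * f m.
Proof.
move=> le; rewrite /malg_ext (big_fset_incl _ le) //= => y yd /mcoeff_outdom ->.
by rewrite raddf0 mul0r.
Qed.

Lemma free_word_algebra : word_algebra K I.
Proof.
pose w (s : seq I) : fa := << FMonom s >>.
have w0 : w [::] = 1 by rewrite /w -fmoneE.
have wM a b : w (a ++ b) = w a * w b.
  by rewrite /w malgM_def fgmulUU mulr1 /mmul /= fmmulE.
have w_span (x : fa) : exists s : seq (K * seq I),
    x = \sum_(p <- s) sc p.1 * w p.2.
  exists [seq (x@_m, fmonom_val m) | m <- msupp x].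
  rewrite big_map {1}(monalgE x); apply: eq_bigr => m _ /=.
  by rewrite malgM_def fgmulUU mulr1 mul1m fmK.
apply: (WordAlgebra w0 wM w_span (wext := malg_ext)) => B f => [a x y|s].
  (* A common finite support, over which all three sums can be taken. *)
  pose E := (msupp x `|` msupp y `|` msupp (sc a * x + y))%fset.
  have xE : (msupp x `<=` E)%fset by rewrite /E -fsetUA fsubsetUl.
  have yE : (msupp y `<=` E)%fset by rewrite /E (fsetUC (msupp x)) -fsetUA
    fsubsetUl.
  have xyE : (msupp (sc a * x + y) `<=` E)%fset by rewrite /E fsubsetUr.
  rewrite (malg_extw f xE) (malg_extw f yE) (malg_extw f xyE) mulr_sumr.
  rewrite -big_split /=; apply: eq_bigr => m _.
  by rewrite mcoeffD mcoeffCM raddfD /= rmorphM /= mulrDl mulrA.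
by rewrite (malg_extw f msuppU_le) big_seq_fset1 mcoeffUU rmorph1 mul1r.
Qed.

End FreeAlgebra.

(** * Homomorphisms from the free algebra, and its grading and filtration by word length *)

Section WordAlgebra.
Context {K : comNzRingType} {I : eqType} (F : word_algebra K I).
Local Notation word := (@word K I F).

Lemma word_cons i w : word (i :: w) = word [:: i] * word w.
Proof. by rewrite -cat1s wordM. Qed.

Lemma klinear_ext (B : kalgType K) (f g : F -> B) :
  klinear f -> klinear g -> (forall w, f (word w) = g (word w)) -> f =1 g.
Proof.
move=> lf lg fg x; have [s ->] := word_span x.
rewrite (klinear_sum lf) (klinear_sum lg).
by apply: eq_bigr => p _; rewrite (klinearZ lf) (klinearZ lg) fg.
Qed.

Lemma word_hom_ext (B : kalgType K) (f g : algHom F B) :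
  (forall i, f (word [:: i]) = g (word [:: i])) -> f =1 g.
Proof.
move=> fg; apply: klinear_ext; [exact: klinear_hom|exact: klinear_hom|].
elim=> [|i w IHw]; first by rewrite word0 !rmorph1.
by rewrite word_cons !ahM fg IHw.
Qed.

Section Lift.
Variables (B : kalgType K) (f : I -> B).
Let lift : F -> B := wext (fun w => \prod_(i <- w) f i).

Let klinear_lift : klinear lift. Proof. exact: klinear_wext. Qed.

Fact word_lift_is_zmod_morphism : zmod_morphism lift.
Proof. exact: klinearB. Qed.

Fact word_lift1 : lift 1 = 1.
Proof. by rewrite -word0 /lift wext_word big_nil. Qed.

Fact word_lift_is_monoid_morphism : monoid_morphism lift.
Proof.
split=> [|x y]; first exact: word_lift1.
move: x; apply: klinear_ext => [||a].
- by apply: klinear_comp => //; apply: klinear_mulr.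
- exact: klinear_mulr.
move: y; apply: klinear_ext => [||b].
- by apply: klinear_comp => //; apply: klinear_mull.
- exact: klinear_mull.
by rewrite -wordM /lift !wext_word big_cat.
Qed.

Fact word_lift_sc a : lift (sc a) = sc a.
Proof. by rewrite -[sc a]mulr1 (klinearZ klinear_lift) word_lift1 mulr1. Qed.

Definition word_lift : algHom F B := AlgHom word_lift_is_zmod_morphism
  word_lift_is_monoid_morphism word_lift_sc.

Lemma word_liftE i : word_lift (word [:: i]) = f i.
Proof. by rewrite [LHS]wext_word big_seq1. Qed.
End Lift.

Section Wext.
Context {B : kalgType K}.
Implicit Types f : seq I -> B.

Lemma wext_ext f f' : f =1 f' -> @wext K I F B f =1 wext f'.
Proof.
move=> ff'; apply: klinear_ext; [exact: klinear_wext|exact: klinear_wext|].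
by move=> w; rewrite !wext_word.
Qed.

Lemma wext_ind (P : B -> Prop) f (x : F) :
  P 0 -> (forall u v, P u -> P v -> P (u + v)) ->
  (forall a u, P u -> P (sc a * u)) -> (forall w, P (f w)) -> P (wext f x).
Proof.
move=> P0 PD PZ Pf; have [s ->] := word_span x.
rewrite (klinear_sum (klinear_wext f)); elim/big_ind: _ => // p _.
by rewrite (klinearZ (klinear_wext f)) wext_word; apply: PZ.
Qed.

End Wext.

(** The homogeneous component of degree [k]. That [x] is homogeneous of degree [k] is written
    [wcomp k x = x] below. *)
Definition wcomp (k : nat) : F -> F :=
  wext (fun w => if size w == k then word w else 0).

Lemma klinear_wcomp k : klinear (wcomp k). Proof. exact: klinear_wext. Qed.

Lemma wext_comp (B : kalgType K) (f : seq I -> B) k x :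
  wext f (wcomp k x) = wext (fun w => if size w == k then f w else 0) x.
Proof.
move: x; apply: klinear_ext => [||w]; [|exact: klinear_wext|].
  by apply: klinear_comp; apply: klinear_wext.
rewrite /wcomp !wext_word; case: ifP => _; first by rewrite wext_word.
by rewrite (klinear0 (klinear_wext f)).
Qed.

Lemma wext_homog (B : kalgType K) (f f' : seq I -> B) k x :
  wcomp k x = x -> (forall w, size w = k -> f w = f' w) -> wext f x = wext f' x.
Proof.
move=> <- ff'; rewrite !wext_comp; apply: wext_ext => w.
by case: eqP => // /ff'.
Qed.

Lemma wext_homog_ind (B : kalgType K) (P : B -> Prop) (f : seq I -> B) k x :
  wcomp k x = x ->
  P 0 -> (forall u v, P u -> P v -> P (u + v)) ->
  (forall a u, P u -> P (sc a * u)) ->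
  (forall w, size w = k -> P (f w)) -> P (wext f x).
Proof.
move=> <- P0 PD PZ Pf; rewrite wext_comp; apply: wext_ind => // w.
by case: eqP => // /Pf.
Qed.

Lemma wcomp_word w : wcomp (size w) (word w) = word w.
Proof. by rewrite /wcomp wext_word eqxx. Qed.

Lemma wcomp_id k x : wcomp k (wcomp k x) = wcomp k x.
Proof. by rewrite [LHS]wext_comp; apply: wext_ext => w; case: eqP. Qed.

Lemma wcompM k l x y :
  wcomp k x = x -> wcomp l y = y -> wcomp (k + l) (x * y) = x * y.
Proof.
move=> xk yl; rewrite -xk -yl.
have lc := klinear_wcomp.
move: x {xk}; apply: klinear_ext => [||w].
- by apply/klinear_comp/klinear_mulr/lc/lc.
- exact/klinear_mulr/lc.
rewrite {2 4}/wcomp wext_word; case: eqP => [<-|_]; last first.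
  by rewrite !mul0r (klinear0 (lc _)).
move: y {yl}; apply: klinear_ext => [||w'].
- by apply/klinear_comp/klinear_mull/lc/lc.
- exact/klinear_mull/lc.
rewrite {2 3}/wcomp wext_word; case: eqP => [<-|_]; last first.
  by rewrite !mulr0 (klinear0 (lc _)).
by rewrite -wordM -size_cat wcomp_word.
Qed.

Lemma wcomp_sum x : exists N, x = \sum_(k < N) wcomp k x.
Proof.
have [s xs] := word_span x.
exists (\max_(p <- s) size p.2).+1.
have xk k : wcomp k x = \sum_(p <- s) sc p.1 * wcomp k (word p.2).
  rewrite xs (klinear_sum (klinear_wcomp k)); apply: eq_bigr => p _.
  by rewrite (klinearZ (klinear_wcomp k)).
rewrite (eq_bigr _ (fun (k : 'I__) _ => xk k)) exchange_big {1}xs.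
rewrite big_seq [RHS]big_seq; apply: eq_bigr => p ps.
have lt_p : (size p.2 < (\max_(p <- s) size p.2).+1)%N.
  by rewrite ltnS (@leq_bigmax_seq _ _ xpredT (fun p : K * seq I =>
    size p.2) p).
rewrite (bigD1 (Ordinal lt_p)) //= wcomp_word big1 ?addr0 // => k kp.
rewrite /wcomp wext_word; case: eqP => [pk|]; last by rewrite mulr0.
by case/eqP: kp; apply: val_inj.
Qed.

Lemma wcomp_comp k l x : wcomp k (wcomp l x) = if k == l then wcomp l x else 0.
Proof.
have [->|neq_kl] := eqVneq k l; first exact: wcomp_id.
rewrite [LHS]wext_comp; apply: (wext_ind (P := eq^~ 0)) => //.
- by move=> _ _ -> ->; rewrite addr0.
- by move=> a _ ->; rewrite mulr0.
move=> w; case: eqP => // wl; case: eqP => // wk.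
by rewrite -wl -wk eqxx in neq_kl.
Qed.

Definition wfil_mem (m : nat) (x : F) : Prop :=
  forall k, (m < k)%N -> wcomp k x = 0.

Lemma wfil_memE m x : wfil_mem m x -> x = \sum_(k < m.+1) wcomp k x.
Proof.
move=> xm; have [N xN] := wcomp_sum x; pose M := maxn N m.+1.
transitivity (\sum_(k < M) wcomp k x); last first.
  rewrite (big_ord_widen M (wcomp^~ x) (leq_maxr _ _)) [RHS]big_mkcond /=.
  by apply: eq_bigr => k _; rewrite ltnS; case: leqP => // /xm.
rewrite {1}xN (big_ord_widen M (wcomp^~ x) (leq_maxl _ _)) [LHS]big_mkcond /=.
apply: eq_bigr => k _; case: ltnP => // le_Nk.
rewrite xN (klinear_sum (klinear_wcomp k)) big1 // => i _.
by rewrite wcomp_comp gtn_eqF // (leq_trans _ le_Nk).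
Qed.

Lemma wfil_homog k m x : wcomp k x = x -> (k <= m)%N -> wfil_mem m x.
Proof.
move=> <- le_km l lt_ml; rewrite wcomp_comp gtn_eqF //.
exact: leq_ltn_trans lt_ml.
Qed.

Fact wfil0 m : wfil_mem m 0.
Proof. by move=> k _; rewrite (klinear0 (klinear_wcomp k)). Qed.

Fact wfilD m x y : wfil_mem m x -> wfil_mem m y -> wfil_mem m (x + y).
Proof. by move=> xm ym k mk;
  rewrite (klinearD (klinear_wcomp k)) xm // ym // addr0. Qed.

Lemma wfil_sum m (J : Type) (r : seq J) (Q : pred J) (G : J -> F) :
  (forall i, Q i -> wfil_mem m (G i)) -> wfil_mem m (\sum_(i <- r | Q i) G i).
Proof. by move=> Gm; elim/big_ind: _ => //; [apply: wfil0|apply: wfilD]. Qed.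

Fact wfil1 : wfil_mem 0 1.
Proof. by rewrite -word0; apply: wfil_homog (wcomp_word [::]) _. Qed.

Fact wfilZ m a x : wfil_mem m x -> wfil_mem m (sc a * x).
Proof. by move=> xm k mk; rewrite (klinearZ (klinear_wcomp k)) xm // mulr0. Qed.

Fact wfilM m l x y : wfil_mem m x -> wfil_mem l y -> wfil_mem (m + l) (x * y).
Proof.
move=> /wfil_memE-> /wfil_memE->; rewrite mulr_suml; apply: wfil_sum => i _.
rewrite mulr_sumr; apply: wfil_sum => j _.
apply: (@wfil_homog (i + j)); first by apply: wcompM; apply: wcomp_id.
by rewrite leq_add // -ltnS.
Qed.

Fact wfilS m x : wfil_mem m x -> wfil_mem m.+1 x.
Proof. by move=> xm k /ltnW; apply: xm. Qed.

Definition wfil : filtration F :=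
  Filtration wfil0 wfil1 wfilD wfilZ wfilM wfilS.

End WordAlgebra.

(** * Coefficients in Rees algebras *)

Lemma reesD (K : comNzRingType) (A : kalgType K) (F : filtration A)
  (p q : rees F) k : (p + q) k = p k + q k.
Proof. by []. Qed.

Lemma rees_sumE (K : comNzRingType) (A : kalgType K) (F : filtration A)
    (J : Type) (r : seq J) (P : pred J) (G : J -> rees F) k :
  (\sum_(i <- r | P i) G i) k = \sum_(i <- r | P i) G i k.
Proof. by apply: (big_morph (fun q : rees F => q k)). Qed.

Lemma reesZ (K : comNzRingType) (A : kalgType K) (F : filtration A) a
  (p : rees F) k : (sc a * p) k = sc a * p k.
Proof. exact: rees_scMl. Qed.

Lemma rees_monoE (K : comNzRingType) (A : kalgType K) (F : filtration A) m x
  (Fx : F m x) k : rees_mono Fx k = if k == m then x else 0.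
Proof. by []. Qed.

Lemma klinear_rees (K : comNzRingType) (A B : kalgType K) (F : filtration B)
  (h : algHom A (rees F)) k : klinear (fun x => h x k).
Proof. by move=> a x y; rewrite (klinear_hom h) reesD reesZ. Qed.

Lemma rees_mono1M (K : comNzRingType) (A : kalgType K) (F : filtration A) x
    (Fx : F 1%N x) (p : rees F) k :
  (rees_mono Fx * p) k = if k is k'.+1 then x * p k' else 0.
Proof.
case: k => [|k] /=; first by rewrite big_ord1 mul0r.
rewrite 2!big_ord_recl /= mul0r add0r subn1 big1 ?addr0 // => i _.
by rewrite mul0r.
Qed.

Lemma rees_mul_mono0 (K : comNzRingType) (A : kalgType K) (F : filtration A) x
    (Fx : F 0%N x) (p : rees F) k :
  (p * rees_mono Fx) k = p k * x.
Proof.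
rewrite /= big_ord_recr /= subnn big1 ?add0r // => i _.
by rewrite subn_eq0 leqNgt ltn_ord mulr0.
Qed.

(** Since every step is all of [A], its Rees algebra is the polynomial ring A[t]; this is the target
    in which degrees in SV are recorded. *)
Definition trivial_filtration (K : comNzRingType) (A : kalgType K) :
  filtration A := @Filtration K A (fun _ _ => True) (fun _ => I) I
    (fun _ _ _ _ _ => I) (fun _ _ _ _ => I) (fun _ _ _ _ _ _ => I)
    (fun _ _ _ => I).

(** * The grading of the symmetric algebra *)

Section SymmetricGrading.
Context {K : fieldType} {V : vectType K} {n : nat} {b : n.-tuple V}.
Hypothesis bP : basis_of fullv b.
Variable F : word_algebra K 'I_n.

(* T(V) is the free algebra on the basis [b]; this is the inclusion of V. *)
Definition fa_vec (v : V) : F := \sum_(i < n) sc (coord b i v) * word F [:: i].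

Lemma fa_vec_linear : linear_to fa_vec.
Proof.
by apply: linear_to_bigsum => i; apply: linear_to_scalar => a u v;
  rewrite linearP.
Qed.

Lemma fa_vec_bas (i : 'I_n) : fa_vec b`_i = word F [:: i].
Proof.
rewrite /fa_vec (bigD1 i) //= coord_free ?(basis_free bP) // eqxx rmorph1 mul1r.
rewrite big1 ?addr0 // => j ji; rewrite coord_free ?(basis_free bP) //.
by rewrite eq_sym (negPf ji) raddf0 mul0r.
Qed.

Lemma hom_fa_vec (B : kalgType K) (h : algHom F B) (f : V -> B) :
  linear_to f -> (forall i : 'I_n, h (word F [:: i]) = f b`_i) ->
  forall v, h (fa_vec v) = f v.
Proof.
move=> lf hf; apply: (linear_to_ext bP) => // [|i].
  exact/linear_to_comp/fa_vec_linear.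
by rewrite fa_vec_bas hf.
Qed.

Lemma wcomp_vec v : wcomp 1 (fa_vec v) = fa_vec v.
Proof.
rewrite /fa_vec (klinear_sum (klinear_wcomp 1)); apply: eq_bigr => i _.
by rewrite (klinearZ (klinear_wcomp 1)) (wcomp_word F [:: i]).
Qed.

Definition fa_sym : algHom F (sym V) := word_lift F (fun i : 'I_n => svec b`_i).

Lemma fa_sym_vec v : fa_sym (fa_vec v) = svec v.
Proof.
by apply: hom_fa_vec v => [|i]; [exact: svec_linear|rewrite word_liftE].
Qed.

Lemma fa_sym_surj x : exists f, x = fa_sym f.
Proof.
move: x; apply: sym_ind => [a|v|_ _ [f ->] [g ->]|_ _ [f ->] [g ->]].
- by exists (sc a); rewrite ah_sc.
- by exists (fa_vec v); rewrite fa_sym_vec.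
- by exists (f + g); rewrite ahD.
- by exists (f * g); rewrite ahM.
Qed.

Definition sym_mono (v : V) : rees (trivial_filtration (sym V)) :=
  @rees_mono K (sym V) (trivial_filtration (sym V)) 1 (svec v) I.

Fact sym_mono_linear : linear_to sym_mono.
Proof.
move=> a u v; apply: reesP => k.
transitivity (sc a * sym_mono u k + sym_mono v k).
  by rewrite /=; case: eqP => _; rewrite ?svec_linear // mulr0 addr0.
by rewrite reesD reesZ.
Qed.

Lemma sym_monoM (v : V) (p : rees (trivial_filtration (sym V))) k :
  (sym_mono v * p) k = if k is k'.+1 then svec v * p k' else 0.
Proof. exact: rees_mono1M. Qed.

Fact sym_monoC u v : sym_mono u * sym_mono v = sym_mono v * sym_mono u.
Proof.
apply: reesP => k; rewrite !sym_monoM; case: k => [|k]; first by [].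
rewrite /sym_mono !rees_monoE; case: eqP => _; first exact: svecC.
by rewrite !mulr0.
Qed.

(** Sends [v] to v t in the polynomial ring over SV, so that the coefficient of t^k is the component
    of degree k. *)
Definition sym_deg : algHom (sym V) (rees (trivial_filtration (sym V))) :=
  sym_lift sym_mono_linear sym_monoC.

Definition sym_comp (k : nat) (x : sym V) : sym V := sym_deg x k.

Lemma klinear_sym_comp k : klinear (sym_comp k).
Proof.
by move=> a x y; rewrite /sym_comp ahD ahM ah_sc reesD reesZ.
Qed.

Lemma sym_comp_word k w :
  sym_comp k (fa_sym (word F w)) = if size w == k then fa_sym (word F w) else 0.
Proof.
elim: w k => [|i w IHw] k.
  by rewrite word0 rmorph1 /sym_comp rmorph1 /= eq_sym.
rewrite word_cons ahM /sym_comp ahM word_liftE sym_liftE sym_monoM.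
case: k => [//|k]; rewrite -/(sym_comp k _) IHw [size _]/= eqSS.
by case: eqP; rewrite ?mulr0.
Qed.

Lemma sym_comp_fa k f : sym_comp k (fa_sym f) = fa_sym (wcomp k f).
Proof.
move: f; apply: klinear_ext => [||w].
- by apply: klinear_comp; [apply: klinear_sym_comp|apply: klinear_hom].
- by apply: klinear_comp; [apply: klinear_hom|apply: klinear_wcomp].
rewrite sym_comp_word /wcomp wext_word; case: eqP => // _.
by rewrite raddf0.
Qed.

Lemma sym_comp_id k x : sym_comp k (sym_comp k x) = sym_comp k x.
Proof. by have [f ->] := fa_sym_surj x; rewrite !sym_comp_fa wcomp_id. Qed.

Lemma sym_comp_eq0 x : (forall k, sym_comp k x = 0) -> x = 0.
Proof.
have [f ->] := fa_sym_surj x; have [N fN] := wcomp_sum f => f0.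
rewrite fN (klinear_sum (klinear_hom fa_sym)); apply: big1 => k _.
by rewrite -sym_comp_fa f0.
Qed.


(** Each coordinate form extends to a homomorphism from SV to the free algebra on one generator, and
    the coefficient at that generator recovers the coordinate of [v]. *)
Lemma svec_eq0 (v : V) : svec v = 0 -> v = 0.
Proof.
move=> v0; rewrite (coord_basis bP (memvf v)) big1 // => i _.
pose f (u : V) : {malg K[{fmonom unit}]} :=
  sc (coord (b) i u) * fa_gen tt.
have lf : linear_to f.
  by apply: linear_to_scalar => a u w; rewrite linearP.
have fC u w : f u * f w = f w * f u.
  exact: scM_comm.
have := congr1 (fun x => (sym_lift lf fC x)@_(fmu tt)) v0.
rewrite sym_liftE raddf0 mcoeff0 /f mcoeffCM mcoeffU eqxx mulr1 => ->.
by rewrite scale0r.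
Qed.

End SymmetricGrading.

(** * The normal form *)

Section NormalForm.
Context {K : fieldType} {V : vectType K} {n : nat} {b : n.-tuple V}.
Hypothesis bP : basis_of fullv b.
Variable F : word_algebra K 'I_n.
Context {gT : finGroupType}.
Variables (rho : linrep gT V) (k : gT -> V -> V -> K).
Local Notation word := (word F).
Local Notation psi := (@fa_vec K V n b F).
Variables (S : kalgType K) (grp : gT -> S).
Hypothesis grpM : forall g h, grp (g * h)%g = grp g * grp h.

Hypothesis kP : forall g y a u v, k g (a *: u + v) y = a * k g u y + k g v y.
Hypothesis kxx : forall g x, k g x x = 0.
Hypothesis kN : forall g x y, k g x y = - k g y x.
Hypothesis kJ : forall h g x y, k g (rho h x) (rho h y) = k (g ^ h)%g x y.
Hypothesis jacobi : forall g x y z,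
  k g x y *: (z - rho g z) + k g y z *: (x - rho g x)
  + k g z x *: (y - rho g y) = 0.

Definition fa_act (g : gT) : algHom F F :=
  word_lift F (fun i => psi (rho g b`_i)).

Lemma fa_act_vec g v : fa_act g (psi v) = psi (rho g v).
Proof.
apply: (hom_fa_vec bP (h := fa_act g) (f := fun v => psi (rho g v))) =>
  [a u w|i].
  by rewrite linearP fa_vec_linear.
exact: word_liftE.
Qed.

Lemma fa_actM g h x : fa_act (g * h)%g x = fa_act g (fa_act h x).
Proof.
move: x; apply: (word_hom_ext (g := ah_comp (fa_act g) (fa_act h))) => i.
by rewrite ah_compE -(fa_vec_bas bP) !fa_act_vec lrM comp_lfunE.
Qed.

Lemma wcomp_act g w : wcomp (size w) (fa_act g (word w)) = fa_act g (word w).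
Proof.
elim: w => [|i w IHw]; first by rewrite word0 rmorph1 -word0 wcomp_word.
rewrite word_cons ahM -[size _]/(1 + size w)%N; apply: wcompM => //.
by rewrite -(fa_vec_bas bP) fa_act_vec wcomp_vec.
Qed.

(* the value of the normal form [N], extended to the free algebra, at
   [A kappa(u, v) B] *)
Definition kappa_term (N : seq 'I_n -> S) (A : F) (u v : V) (B : F) : S :=
  \sum_g sc (k g u v) * (wext N (A * fa_act g B) * grp g).

(** One use of kappa leads from [N] to [N']. The two may differ because the parts of the normal form
    are linked by a recursion; the full normal form satisfies the rule with [N = N']. *)
Definition comm_rule (N N' : seq 'I_n -> S) : Prop := forall A u v B,
  wext N (A * (psi u * psi v - psi v * psi u) * B) = kappa_term N' A u v B.

Lemma kappa_termN N A u v B : kappa_term N A u v B = - kappa_term N A v u B.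
Proof.
rewrite /kappa_term -sumrN; apply: eq_bigr => g _.
by rewrite kN raddfN mulNr.
Qed.

Lemma klinear_kappa_terml N u v B : klinear (fun A => kappa_term N A u v B).
Proof.
apply: klinear_bigsum => g _; apply/klinear_mull/klinear_mulr.
apply: klinear_comp; first exact: klinear_wext.
exact/klinear_mulr.
Qed.

Lemma klinear_kappa_termr N A u v : klinear (kappa_term N A u v).
Proof.
apply: klinear_bigsum => g _; apply/klinear_mull/klinear_mulr.
apply: klinear_comp; first exact: klinear_wext.
by apply: klinear_mull; apply: klinear_hom.
Qed.

Lemma linear_to_kappa_term N A v B : linear_to (fun u => kappa_term N A u v B).
Proof.
by apply: linear_to_bigsum => g; apply: linear_to_scalar => a u w; apply: kP.
Qed.

Lemma word_swap p (i j : 'I_n) q :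
  word (p ++ i :: j :: q) - word (p ++ j :: i :: q) =
  word p * (psi b`_i * psi b`_j - psi b`_j * psi b`_i) * word q.
Proof.
have wij i' j' : word (p ++ i' :: j' :: q) =
  word p * (psi b`_i' * psi b`_j') * word q.
  by rewrite -cat1s -(cat1s j') !wordM !(fa_vec_bas bP) !mulrA.
by rewrite !wij mulrBr mulrBl.
Qed.

(** Both sides are linear in each of [A], [u], [v] and [B], so words and basis vectors suffice. *)
Lemma comm_rule_words N N' :
  (forall a (x y : 'I_n) c, N (a ++ x :: y :: c) - N (a ++ y :: x :: c) =
     kappa_term N' (word a) b`_x b`_y (word c)) ->
  comm_rule N N'.
Proof.
move=> NN' A u v B; have lN : klinear (wext N : F -> S) by apply: klinear_wext.
have lL v' A' B' : linear_to (fun u' =>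
    wext N (A' * (psi u' * psi v' - psi v' * psi u') * B')).
  move=> a u1 u2; rewrite -lN; congr (wext N _).
  have -> : psi (a *: u1 + u2) * psi v' - psi v' * psi (a *: u1 + u2) =
      sc a * (psi u1 * psi v' - psi v' * psi u1)
      + (psi u2 * psi v' - psi v' * psi u2).
    rewrite fa_vec_linear mulrDl [X in _ - X]mulrDr mulr_scA -mulrA mulrBr.
    by rewrite opprD addrACA.
  by rewrite mulrDr mulrDl mulr_scA -(mulrA (sc a)).
move: A; apply: klinear_ext => [||a].
- by apply: klinear_comp => //; do 2!apply: klinear_mulr.
- exact: klinear_kappa_terml.
move: B; apply: klinear_ext => [||c].
- by apply: klinear_comp => //; apply: klinear_mull.
- exact: klinear_kappa_termr.
move: u; apply: (linear_to_ext bP) => [||x].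
- exact: lL.
- exact: linear_to_kappa_term.
(* Antisymmetry exchanges [x] and [v], so that linearity in the first vector also serves for the
   second. *)
have -> : wext N (word a * (psi b`_x * psi v - psi v * psi b`_x) * word c)
    = - wext N (word a * (psi v * psi b`_x - psi b`_x * psi v) * word c).
  by rewrite -(opprB (psi v * _)) mulrN mulNr (klinearN lN).
rewrite kappa_termN; congr (- _).
move: v; apply: (linear_to_ext bP) => [||y].
- exact: lL.
- exact: linear_to_kappa_term.
rewrite -NN' -[N (a ++ [:: x, y & c])](wext_word F).
rewrite -[N (a ++ [:: y, x & c])](wext_word F) -(klinearB lN).
by rewrite word_swap.
Qed.

Section Step.
Variables N N' : seq 'I_n -> S.
Hypothesis NN' : comm_rule N N'.

Definition kappa_cost (a : seq 'I_n) (x y : 'I_n) (c : seq 'I_n) : S :=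
  kappa_term N (word a) b`_x b`_y (word c).

Fact kappa_cost_same a x c : kappa_cost a x x c = 0.
Proof. by apply: big1 => g _; rewrite kxx raddf0 mul0r. Qed.

Fact kappa_cost_anti a x y c : kappa_cost a x y c = - kappa_cost a y x c.
Proof. exact: kappa_termN. Qed.

(* Both sides are the value at a word with two disjoint commutators, each
   replaced by kappa; equivariance makes the order of replacement irrelevant. *)
Fact kappa_cost_far a x y c z t d :
  kappa_cost a x y (c ++ z :: t :: d) - kappa_cost a x y (c ++ t :: z :: d) =
  kappa_cost (a ++ x :: y :: c) z t d - kappa_cost (a ++ y :: x :: c) z t d.
Proof.
have rB A u v B B' : kappa_term N A u v B - kappa_term N A u v B' =
  kappa_term N A u v (B - B') by rewrite (klinearB (klinear_kappa_termr _ _ _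
    _)).
have lB A A' u v B : kappa_term N A u v B - kappa_term N A' u v B =
  kappa_term N (A - A') u v B by rewrite (klinearB (klinear_kappa_terml _ _ _
    _)).
rewrite /kappa_cost [RHS]lB [LHS]rB !word_swap.
have gB g u v : fa_act g (psi u * psi v - psi v * psi u) =
    psi (rho g u) * psi (rho g v) - psi (rho g v) * psi (rho g u).
  by rewrite (klinearB (klinear_hom _)) !ahM !fa_act_vec.
transitivity (\sum_g \sum_h sc (k g b`_x b`_y) * (sc (k h b`_z b`_t) *
    (wext N' (word a * fa_act g (word c) * fa_act (g * h)%g (word d)) *
      grp (g * h)%g))).
  apply: eq_bigr => g _; rewrite -mulr_sumr; congr (_ * _).
  rewrite !ahM gB.
  rewrite !mulrA NN' mulr_suml.
  (* The inner commutator has been acted on by [g]. By equivariance its coefficient at g h g^-1 is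
     the original one at [h], and (g h g^-1) g = g h. *)
  rewrite (reindex_inj (@conjg_inj _ g^-1%g)); apply: eq_bigr => h _.
  have hg : (h ^ g^-1 * g = g * h)%g by rewrite conjgC conjgKV.
  by rewrite kJ conjgKV -fa_actM hg -!mulrA -grpM hg.
rewrite exchange_big; apply: eq_bigr => h _.
rewrite -(mulrA _ (word c)) NN' mulr_suml mulr_sumr; apply: eq_bigr => g _.
by rewrite grpM ahM -fa_actM mulr_scA !mulrA.
Qed.

(** For each [g], a third letter to the left of the commutator enters as itself and one to the right
    as its image under [rho g]. The two sides therefore differ by the linear map [L g] at the Jacobi
    sum. *)
Fact kappa_cost_braid a x y z d :
  kappa_cost a x y (z :: d) + kappa_cost (rcons a y) x z d
    + kappa_cost a y z (x :: d) =
  kappa_cost (rcons a x) y z d + kappa_cost a x z (y :: d)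
    + kappa_cost (rcons a z) x y d.
Proof.
pose L g v := wext N (word a * psi v * fa_act g (word d)) * grp g.
have lL g : linear_to (L g).
  move=> c u v; rewrite /L fa_vec_linear mulrDr mulrDl mulr_scA -(mulrA (sc c)).
  by rewrite (klinear_wext N) mulrDl mulrA.
have cost1 (i j l : 'I_n) : kappa_cost a i j (l :: d) =
    \sum_g L g (k g b`_i b`_j *: rho g b`_l).
  apply: eq_bigr => g _; rewrite (linear_toZ (lL g)) /L word_cons ahM.
  by rewrite -(fa_vec_bas bP) fa_act_vec (mulrA (word a)).
have cost2 (i j l : 'I_n) : kappa_cost (rcons a l) i j d =
    \sum_g L g (k g b`_i b`_j *: b`_l).
  apply: eq_bigr => g _; rewrite (linear_toZ (lL g)) /L -cats1 wordM.
  by rewrite -(fa_vec_bas bP).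
rewrite !(cost1, cost2) -!big_split; apply: eq_bigr => g _ /=.
rewrite -!(linear_toD (lL g)); congr (L g _); apply/esym/eqP.
rewrite -subr_eq0 -[X in _ == X](jacobi g b`_x b`_y b`_z) (kN g b`_z) scaleNr
  !scalerBr.
set p := _ *: b`_z; set p' := _ *: rho g b`_z.
set q := _ *: b`_x; set q' := _ *: rho g b`_x.
set r := _ *: b`_y; set r' := _ *: rho g b`_y.
apply/eqP; rewrite opprB [p - p' + _]addrACA [RHS]addrACA -!opprD.
by rewrite (addrAC p' r) (addrC (q + r')) addrA.
Qed.

Lemma comm_rule_step : comm_rule (sort_cost kappa_cost [::]) N.
Proof.
apply: comm_rule_words => a x y c.
by rewrite (sort_cost_swap kappa_cost_same kappa_cost_anti kappa_cost_far
  kappa_cost_braid).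
Qed.

End Step.

Variable sigma : algHom F S.
Hypothesis sigmaC : forall u v, sigma (psi u) * sigma (psi v) =
  sigma (psi v) * sigma (psi u).

(* [nform_part j] collects the terms of the normal form in which [kappa] is
   used [j] times. *)
Fixpoint nform_part (j : nat) : seq 'I_n -> S :=
  if j is j'.+1 then sort_cost (kappa_cost (nform_part j')) [::]
  else fun w => sigma (word w).

Lemma wext_hom (B : kalgType K) (f : algHom F B) x :
  wext (fun w => f (word w)) x = f x.
Proof.
move: x; apply: klinear_ext => [||w]; rewrite ?wext_word //.
  exact: klinear_wext.
exact: klinear_hom.
Qed.

Lemma nform_part_rule0 : comm_rule (nform_part 0) (fun=> 0).
Proof.
move=> A u v B; rewrite [LHS]wext_hom !ahM (klinearB (klinear_hom _)) !ahM.
rewrite sigmaC subrr mulr0 mul0r /kappa_term big1 // => g _.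
have -> (x : F) : wext (fun=> 0) x = 0 :> S.
  by apply: (wext_ind (P := eq^~ 0)) => // [_ _ -> ->|c _ ->];
    rewrite ?addr0 ?mulr0.
by rewrite mul0r mulr0.
Qed.

Lemma nform_part_rule j : comm_rule (nform_part j.+1) (nform_part j).
Proof.
elim: j => [|j IHj]; first exact: comm_rule_step nform_part_rule0.
exact: comm_rule_step IHj.
Qed.

(** The bound loses nothing: each use of kappa removes two letters, so the parts with [j] beyond the
    length of [w] vanish ([nform_part_small]). *)
Definition nform (w : seq 'I_n) : S := \sum_(j < (size w).+1) nform_part j w.

Lemma wcomp_word_act a c g :
  wcomp (size a + size c) (word a * fa_act g (word c)) =
    word a * fa_act g (word c).
Proof. by apply: wcompM; [apply: wcomp_word|apply: wcomp_act]. Qed.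

Lemma nform_part_small j w : (size w < j)%N -> nform_part j w = 0.
Proof.
elim: j w => [//|j IHj] w; rewrite ltnS => le_wj /=.
apply: (sort_cost_ind (P := eq^~ 0)) => //= [_ _ -> ->|a x y c];
  first by rewrite addr0.
rewrite add0n => acw; apply: big1 => g _; rewrite [wext _ _](_ : _ =
  0) ?mul0r ?mulr0 //.
apply: (wext_homog_ind (P := eq^~ 0) (wcomp_word_act a c g)) => //.
- by move=> _ _ -> ->; rewrite addr0.
- by move=> ? _ ->; rewrite mulr0.
by move=> w' w'E; apply: IHj; apply: leq_trans le_wj;
  rewrite w'E -acw !addnS ltnS.
Qed.

(** The range of [j] in [nform] depends on the word; on homogeneous elements it can be replaced by
    any sufficiently large common bound. *)
Lemma nform_homog m M (x : F) : wcomp m x = x -> (m < M)%N ->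
  wext nform x = \sum_(j < M) wext (nform_part j) x.
Proof.
move=> xm lt_mM.
rewrite (@wext_homog _ _ _ _ _ (fun w => \sum_(j < M) nform_part j w) m) //.
  move: x {xm}; apply: klinear_ext => [||w].
  - exact: klinear_wext.
  - by apply: klinear_bigsum => j _; apply: klinear_wext.
  by rewrite wext_word; apply: eq_bigr => j _; rewrite wext_word.
move=> w wm; rewrite /nform wm (big_ord_widen M (fun j => nform_part j w)) //.
rewrite big_mkcond; apply: eq_bigr => j _; case: ltnP => // lt_mj.
by rewrite nform_part_small ?wm.
Qed.

Lemma nform_rule : comm_rule nform nform.
Proof.
apply: comm_rule_words => a x y c.
have sz (i j : 'I_n) : size (a ++ [:: i, j & c]) = (size a + size c).+2.
  by rewrite size_cat !addnS.
(* Part 0 contributes nothing because [sigma] takes commuting values on vectors; part j + 1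
   contributes one use of kappa followed by part j. *)
rewrite /nform !sz -sumrB big_ord_recl /= -(klinearB (klinear_hom sigma)).
rewrite word_swap !ahM (klinearB (klinear_hom sigma)) !ahM sigmaC subrr.
rewrite mulr0 mul0r add0r.
transitivity (\sum_(j < (size a + size c).+2)
    kappa_term (nform_part j) (word a) b`_x b`_y (word c)).
  apply: eq_bigr => j _; rewrite -nform_part_rule -word_swap.
  by rewrite (klinearB (klinear_wext _)) !wext_word.
rewrite /kappa_term exchange_big; apply: eq_bigr => g _ /=.
by rewrite -mulr_sumr -mulr_suml -(nform_homog (wcomp_word_act a c g)).
Qed.

(** * Degree of the normal form, with [P m] read as having degree at most [m] *)

Section Degree.
Variable P : nat -> S -> Prop.
Hypothesis P0 : forall m, P m 0.
Hypothesis PD : forall m u v, P m u -> P m v -> P m (u + v).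
Hypothesis PZ : forall m a u, P m u -> P m (sc a * u).
Hypothesis Pgrp : forall m g u, P m u -> P m (u * grp g).
Hypothesis PS : forall m u, P m u -> P m.+1 u.
Hypothesis Psigma : forall w, P (size w) (sigma (word w)).

Lemma P_leq m m' u : (m <= m')%N -> P m u -> P m' u.
Proof. by move/subnK <-; elim: (m' - m)%N => //= d IHd /IHd; apply: PS. Qed.

(** A use of kappa removes two letters; losing one degree per use is enough for what follows. *)
Lemma nform_part_deg j w : P (size w - j) (nform_part j w).
Proof.
elim: j w => [|j IHj] w; first by rewrite subn0; apply: Psigma.
apply: (sort_cost_ind (P := P _)) => //= [u v Pu Pv|a x y c]; first exact: PD.
rewrite add0n => acw; rewrite /kappa_cost /kappa_term.
elim/big_ind: _ => [|u v Pu Pv|g _]; [exact: P0|exact: PD|].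
apply/PZ/Pgrp; apply: (wext_homog_ind (wcomp_word_act a c g)) => //.
- by move=> u v; apply: PD.
- by move=> a' u; apply: PZ.
move=> w' w'E; apply: P_leq (IHj w'); rewrite w'E -acw !addnS subSS.
by rewrite leq_sub2r.
Qed.

(** Degree less than [m], matching [fil_pred] in the definition of gr. *)
Definition lower (m : nat) (u : S) : Prop := if m is m'.+1 then P m' u else u =
  0.

(** Only part 0, which is [sigma], reaches the full degree. *)
Lemma nform_lead w : lower (size w) (nform w - sigma (word w)).
Proof.
rewrite /nform big_ord_recl /= addrC addKr; case sw: (size w) => [|m] /=.
  by rewrite big_ord0.
elim/big_ind: _ => [|u v Pu Pv|j _]; [exact: P0|exact: PD|].
by apply: P_leq (nform_part_deg j.+1 w); rewrite sw subSS leq_subr.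
Qed.

Lemma nform_deg w : P (size w) (nform w).
Proof.
rewrite -(subrK (sigma (word w)) (nform w)); apply: PD; last exact: Psigma.
by have := nform_lead w; case: (size w) => [|m] /= => [->|]; [apply: P0|apply:
  PS].
Qed.

Lemma lower0 m : lower m 0. Proof. by case: m => //= m; apply: P0. Qed.

Lemma lowerD m u v : lower m u -> lower m v -> lower m (u + v).
Proof. by case: m => [-> ->|m]; [rewrite /= addr0|apply: PD]. Qed.

Lemma lowerZ m a u : lower m u -> lower m (sc a * u).
Proof. by case: m => [->|m]; [rewrite /= mulr0|apply: PZ]. Qed.

Lemma lower_subr m u v : lower m u -> lower m (u - v) -> lower m v.
Proof.
move=> lu luv; have -> : v =
  u + sc (-1) * (u - v) by rewrite scN1r opprB subrKC.
by apply: lowerD => //; apply: lowerZ.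
Qed.

Lemma lower_grp m g u : lower m u -> lower m (u * grp g).
Proof. by case: m => [->|m]; [rewrite /= mul0r|apply: Pgrp]. Qed.

Lemma nform_lead_homog m x : wcomp m x = x -> lower m (wext nform x - sigma x).
Proof.
move=> xm; pose f w := nform w - sigma (word w).
have -> : wext nform x - sigma x = wext f x.
  have lf := klinear_wext f; move: x {xm}; apply: klinear_ext => [||w].
  - have lN := klinear_wext nform => a x y.
    by rewrite lN (klinear_hom sigma) opprD addrACA -mulrBr.
  - exact: klinear_wext.
  by rewrite !wext_word.
apply: (wext_homog_ind xm); first exact: lower0.
- by move=> u v; apply: lowerD.
- by move=> a u; apply: lowerZ.
by move=> w <-; apply: nform_lead.
Qed.

Lemma nform_wfil m x : wfil F m x -> P m (wext nform x).
Proof.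
move=> /wfil_memE->; rewrite (klinear_sum (klinear_wext nform)).
elim/big_ind: _ => [|u v Pu Pv|k' _]; [exact: P0|exact: PD|].
apply: (@P_leq k'); first by rewrite -ltnS.
apply: (wext_homog_ind (wcomp_id k' x)); first exact: P0.
- by move=> u v; apply: PD.
- by move=> a u; apply: PZ.
by move=> w <-; apply: nform_deg.
Qed.

End Degree.

Lemma wfil_act g m x : wfil F m x -> wfil F m (fa_act g x).
Proof.
move=> /wfil_memE->; rewrite (klinear_sum (klinear_hom _)).
apply: fil_sum => i _; apply: (@wfil_homog _ _ _ i); last by rewrite -ltnS.
have lg : klinear (fun y => fa_act g (wcomp i y)).
  by apply: klinear_comp; [apply: klinear_hom|apply: klinear_wcomp].
move: x; apply: klinear_ext => [||w] //.
  by apply: klinear_comp => //; apply: klinear_wcomp.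
rewrite /wcomp wext_word; case: eqP => [<-|_]; first exact: wcomp_act.
by rewrite raddf0; apply/klinear0/klinear_wcomp.
Qed.

(* [T] stands for the smash product C[G] |>< T(V), [A] for T(V) and [nf] for the
   extension of the normal form to [T]. *)
Section SmashNormalForm.
Variables (A T : kalgType K) (alpha : algAct gT A) (inl : algHom A T).
Variable u : gT -> T.
Hypothesis uM : forall g h, u (g * h)%g = u g * u h.
Hypothesis u_inl : forall g a, u g * inl a = inl (alpha g a) * u g.
Hypothesis T_span : forall x, exists a : gT -> A, x = \sum_g inl (a g) * u g.
Variable tv : V -> A.
Hypothesis alpha_tv : forall g v, alpha g (tv v) = tv (rho g v).
Variable phi : algHom A F.
Hypothesis phi_tv : forall v, phi (tv v) = psi v.
Hypothesis phi_alpha : forall g a, phi (alpha g a) = fa_act g (phi a).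
Variable nf : T -> S.
Hypothesis klinear_nf : klinear nf.
Hypothesis nf_inl : forall a g, nf (inl a * u g) = wext nform (phi a) * grp g.

Let rel x y := inl (tv x) * inl (tv y) - inl (tv y) * inl (tv x)
  - \sum_g sc (k g x y) * u g.

(** Moving [g] to the right turns the commutator of [x], [y] into that of their images under [g], to
    which [nform_rule] applies; equivariance matches the result with the kappa term of the
    relation. *)
Let nf_rel_monomial a g x y c h :
  nf (inl a * u g * rel x y * (inl c * u h)) = 0.
Proof.
have u_comm : u g * (inl (tv x) * inl (tv y) - inl (tv y) * inl (tv x)) =
    inl (tv (rho g x) * tv (rho g y) - tv (rho g y) * tv (rho g x)) * u g.
  rewrite (klinearB (klinear_hom inl)) !ahM mulrBr mulrBl !mulrA !u_inl.
  by rewrite -!mulrA !u_inl !alpha_tv !mulrA.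
rewrite /rel mulrBr mulrBl (klinearB klinear_nf) -(mulrA (inl a)) u_comm.
rewrite -!mulrA (mulrA (u g) (inl c)) u_inl -!mulrA -uM !mulrA -!ahM nf_inl.
rewrite !ahM (klinearB (klinear_hom phi)) !ahM !phi_tv phi_alpha nform_rule.
rewrite /kappa_term !(mulr_suml, mulr_sumr) (klinear_sum klinear_nf).
rewrite (reindex_inj (@conjg_inj _ g^-1%g)) -sumrB big1 // => m _.
have hg : (m ^ g^-1 * g = g * m)%g by rewrite conjgC conjgKV.
have -> : inl a * u g * (sc (k m x y) * u m) * inl c * u h =
    sc (k m x y) * (inl (a * alpha (g * m)%g c) * u (g * m * h)%g).
  rewrite mulr_scA -!(mulrA (sc _)) -(mulrA (inl a)) -uM -(mulrA (inl a)) u_inl.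
  by rewrite (mulrA (inl a) (inl _)) -ahM -(mulrA (inl _)) -uM.
rewrite (klinearZ klinear_nf) nf_inl ahM phi_alpha kJ conjgKV -fa_actM hg.
by rewrite -(mulrA (sc _)) -(mulrA (wext _ _)) -grpM mulgA hg subrr.
Qed.

Lemma nf_rel B C x y : nf (B * rel x y * C) = 0.
Proof.
have [bs ->] := T_span B; have [cs ->] := T_span C.
rewrite !mulr_suml (klinear_sum klinear_nf) big1 // => g _.
by rewrite mulr_sumr (klinear_sum klinear_nf) big1.
Qed.

End SmashNormalForm.

End NormalForm.

Lemma sum_single (T : finType) (M : zmodType) (f : T -> M) i :
  (forall j, j != i -> f j = 0) -> \sum_j f j = f i.
Proof. by move=> f0; rewrite (bigD1 i) //= big1 ?addr0. Qed.

Section CoreIdeal.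
Context {K : comNzRingType} {A B : kalgType K} {f : A -> B}.
Hypothesis lf : klinear f.

Let mem (x : A) : Prop := forall y z, f (y * x * z) = 0.

Fact core_ideal0 : mem 0.
Proof. by move=> y z; rewrite mulr0 mul0r (klinear0 lf). Qed.

Fact core_idealD x x' : mem x -> mem x' -> mem (x + x').
Proof.
by move=> x0 x'0 y z; rewrite mulrDr mulrDl (klinearD lf) x0 x'0 addr0.
Qed.

Fact core_idealMl a x : mem x -> mem (a * x).
Proof. by move=> x0 y z; rewrite mulrA; apply: x0. Qed.

Fact core_idealMr a x : mem x -> mem (x * a).
Proof. by move=> x0 y z; rewrite mulrA -(mulrA _ a); apply: x0. Qed.

(** The largest two-sided ideal inside the kernel of [f]. It replaces the kernel, which is no ideal
    in general as [f] is only linear. *)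
Definition core_ideal : ideal A :=
  Ideal core_ideal0 core_idealD core_idealMl core_idealMr.

Lemma core_idealP x : (forall y z, f (y * x * z) = 0) -> core_ideal x.
Proof. by []. Qed.
End CoreIdeal.

Section SmashCoefficients.
Context {K : fieldType} {gT : finGroupType} {A : kalgType K}.
Variable alpha : algAct gT A.

Lemma smash_scE a (x : smash alpha) g : (sc a * x) g = sc a * x g.
Proof.
have -> : sc a * x = smash_in alpha (sc a) * x by [].
by rewrite smash_inMl ffunE.
Qed.

Lemma smash_addE (x y : smash alpha) g : (x + y) g = x g + y g.
Proof. exact: ffunE. Qed.

Lemma klinear_smash_coef g : klinear (fun x : smash alpha => x g).
Proof. by move=> a x y; rewrite smash_addE smash_scE. Qed.

Lemma smash_inl_grpE a g h :
  (smash_inl alpha a * smash_grp alpha g) h = if h == g then a else 0.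
Proof.
rewrite [_ * _]smash_inMl ffunE ffunE.
by case: eqP; rewrite ?mulr1 ?mulr0.
Qed.

Lemma smash_mul_grpE (x : smash alpha) g h :
  (x * smash_grp alpha g) h = x (h * g^-1)%g.
Proof.
rewrite [LHS]ffunE (bigD1 (h * g^-1)%g) //= ffunE invMg invgK mulgKV eqxx.
rewrite rmorph1 mulr1 big1 ?addr0 // => i ih; rewrite ffunE.
case: eqP => [E|_]; last by rewrite raddf0 mulr0.
by case/eqP: ih; rewrite -E invMg invgK mulKVg.
Qed.

Lemma smash_sum_inl_grpE (a : gT -> A) h :
  (\sum_g smash_inl alpha (a g) * smash_grp alpha g) h = a h.
Proof.
rewrite (klinear_sum (klinear_smash_coef h)) (bigD1 h) //=.
rewrite smash_inl_grpE eqxx big1 ?addr0 // => g gh.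
by rewrite smash_inl_grpE eq_sym (negPf gh).
Qed.

End SmashCoefficients.

(** * Injectivity of xi *)

Section PBW.
Context {K : fieldType} {V : vectType K} {gT : finGroupType}.
Context {n : nat} {b : n.-tuple V}.
Hypothesis bP : basis_of fullv b.
Variable F : word_algebra K 'I_n.
Variables (rho : linrep gT V) (kappa : V -> V -> grpalg K gT).
Local Notation k := (fun g x y => kappa x y g : K).
Local Notation GT := (smash (tens_act rho)).
Local Notation GS := (smash (sym_act rho)).
Local Notation psi := (@fa_vec K V n b F).

Hypothesis kP : forall g y a u v, k g (a *: u + v) y = a * k g u y + k g v y.
Hypothesis kxx : forall g x, k g x x = 0.
Hypothesis kN : forall g x y, k g x y = - k g y x.
Hypothesis kJ : forall h g x y, k g (rho h x) (rho h y) = k (g ^ h)%g x y.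
Hypothesis jacobi : forall g x y z,
  k g x y *: (z - rho g z) + k g y z *: (x - rho g x)
  + k g z x *: (y - rho g y) = 0.

Definition tens_fa : algHom (tens V) F := tens_lift (@fa_vec_linear K V n b F).

Lemma tens_fa_vec v : tens_fa (tvec v) = psi v.
Proof. exact: tens_liftE. Qed.

Lemma tens_fa_act g a : tens_fa (tens_act rho g a) =
  @fa_act K V n b F gT rho g (tens_fa a).
Proof.
move: a; apply: (@tens_ext _ _ _ (ah_comp tens_fa (tens_act rho g))
  (ah_comp (@fa_act K V n b F gT rho g) tens_fa)) => v.
by rewrite !ah_compE tens_actE !tens_fa_vec (fa_act_vec bP).
Qed.

Definition sym_in : algHom F GS :=
  ah_comp (smash_inl (sym_act rho)) (@fa_sym K V n b F).

Lemma sym_inC u v : sym_in (psi u) * sym_in (psi v) =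
  sym_in (psi v) * sym_in (psi u).
Proof.
have inE w : sym_in (psi w) = smash_inl (sym_act rho) (svec w).
  by rewrite ah_compE (fa_sym_vec bP).
rewrite !inE.
exact: etrans (esym (ahM _ _ _)) (etrans (congr1 _ (svecC u v)) (ahM _ _ _)).
Qed.

Definition nf_word : seq 'I_n -> GS :=
  @nform K V n b F gT rho k GS (smash_grp (sym_act rho)) sym_in.

Definition nf (x : GT) : GS :=
  \sum_g wext nf_word (tens_fa (x g)) * smash_grp (sym_act rho) g.

Lemma klinear_nf : klinear nf.
Proof.
apply: klinear_bigsum => g _; apply/klinear_mulr/klinear_comp.
  exact: klinear_wext.
by apply: klinear_comp; [apply: klinear_hom|apply: klinear_smash_coef].
Qed.

Lemma nf_inl_grp a g :
  nf (smash_inl (tens_act rho) a * smash_grp (tens_act rho) g) =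
  wext nf_word (tens_fa a) * smash_grp (sym_act rho) g.
Proof.
rewrite /nf (sum_single (i := g)) ?smash_inl_grpE ?eqxx // => h hg.
rewrite smash_inl_grpE (negPf hg) (klinear0 (klinear_hom tens_fa)).
by rewrite (klinear0 (klinear_wext _)) mul0r.
Qed.

(** The defining relations lie in the core ideal of [nf], hence so does the ideal that they
    generate. *)
Lemma nf_Hk0 x : Hk_pi rho kappa x = 0 -> nf x = 0.
Proof.
move=> /quot_pi_eq0 /(_ (core_ideal klinear_nf)) Jx.
have {Jx} : core_ideal klinear_nf x.
  apply: Jx => _ [u v]; apply: core_idealP => B C.
  apply: (@nf_rel K V n b bP F gT rho k GS (smash_grp (sym_act rho))
    (@smash_grpM _ _ _ _) kP kxx kN kJ jacobi sym_in sym_inC (tens V) GT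
    (tens_act rho) (smash_inl (tens_act rho)) (smash_grp (tens_act rho))
    (@smash_grpM _ _ _ _) (@smash_grp_in _ _ _ _) _ (@tvec K V)
    (tens_actE rho) tens_fa tens_fa_vec tens_fa_act nf klinear_nf nf_inl_grp).
  by move=> y; exists y; apply: smash_sum.
by move=> /(_ 1 1); rewrite mulr1 mul1r.
Qed.

(** Induction on the generation of the filtration. The representative has coefficients of bounded
    word length, and so its normal form has bounded degree. *)
Lemma Hk_lift m y : Hk_fil rho kappa m y ->
  exists2 x, Hk_pi rho kappa x = y & forall g, wfil F m (tens_fa (x g)).
Proof.
have t0 : tens_fa 0 = 0 := klinear0 (klinear_hom tens_fa).
have t1 : tens_fa 1 = 1 := rmorph1 tens_fa.
have pi1 : Hk_pi rho kappa 1 = 1 := rmorph1 (Hk_pi rho kappa).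
have wif m' (c : bool) a : wfil F m' (tens_fa a) ->
  wfil F m' (tens_fa (if c then a else 0)).
  by case: c => // _; rewrite t0; apply: fil0.
have wgrp g h : wfil F 0 (tens_fa (smash_grp (tens_act rho) g h)).
  rewrite ffunE; case: eqP => _; last by rewrite t0; apply: fil0.
  by rewrite t1; apply: fil1.
elim=> {m y} [m y [g|v]|m||m _ _ _ [x <- xm] _ [y <- ym]|m a _ _ [x <- xm]
  |m l _ _ _ [x <- xm] _ [y <- yl]|m _ _ [x <- xm]].
- by exists (smash_grp (tens_act rho) g) => // h; apply: wgrp.
- exists (smash_inl (tens_act rho) (tvec v)) => // h; rewrite ffunE.
  apply: wif; rewrite tens_fa_vec.
  by apply: (@wfil_homog _ _ _ 1); first exact: wcomp_vec.
- exists 0; first exact: (klinear0 (klinear_hom _)).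
  by move=> g; rewrite ffunE t0; apply: fil0.
- by exists 1 => // g; apply: (wgrp 1%g).
- exists (x + y); first exact: ahD.
  by move=> g; rewrite smash_addE ahD; apply: filD.
- exists (sc a * x); first by rewrite ahM ah_sc.
  by move=> g; rewrite smash_scE ahM ah_sc; apply: filZ.
- exists (x * y); first exact: ahM.
  move=> g; rewrite [(x * y) g]ffunE (klinear_sum (klinear_hom tens_fa)).
  apply: fil_sum => h _; rewrite ahM tens_fa_act; apply: filM => //.
  exact: wfil_act.
- by exists x => // g; apply: filS.
Qed.

Definition fa_tens : algHom F (tens V) := word_lift F (fun i : 'I_n =>
  tvec b`_i).

Lemma fa_tensK x : tens_fa (fa_tens x) = x.
Proof.
move: x; apply: (@word_hom_ext _ _ _ _ (ah_comp tens_fa fa_tens) (ah_id F)) =>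
  i.
by rewrite ah_compE word_liftE tens_fa_vec (fa_vec_bas bP).
Qed.

(** Lifts [xi_sym] from gr to the Rees algebra ([xi_fa_sym]), where elements have computable
    coefficients. *)
Definition fa_rees : algHom F (rees (Hk_fil rho kappa)) :=
  word_lift F (fun i : 'I_n => rees_mono (Hk_fil_vec rho kappa b`_i)).

Lemma fa_rees_coef x m :
  fa_rees x m = Hk_pi rho kappa (smash_inl (tens_act rho) (fa_tens (wcomp m
    x))).
Proof.
move: x; apply: klinear_ext => [||w].
- exact: klinear_rees.
- by do 3!(apply: klinear_comp; first exact: klinear_hom); apply: klinear_wcomp.
have z0 : Hk_pi rho kappa (smash_inl (tens_act rho) (fa_tens 0)) = 0.
  exact: (klinear0 (klinear_hom (ah_comp (Hk_pi rho kappa)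
    (ah_comp (smash_inl (tens_act rho)) fa_tens)))).
rewrite /wcomp wext_word; elim: w m => [|i w IHw] m.
  rewrite word0 rmorph1 rees_monoE eq_sym; case: eqP => _; last by rewrite z0.
  by rewrite !rmorph1.
rewrite word_cons ahM word_liftE rees_mono1M; case: m => [|m];
  first by rewrite z0.
rewrite IHw [size _]/= eqSS; case: eqP => _; last by rewrite z0 mulr0.
by rewrite !ahM word_liftE.
Qed.

Lemma xi_fa_sym x : xi_sym rho kappa (@fa_sym K V n b F x) =
  quot_pi _ (fa_rees x).
Proof.
move: x; apply: (@word_hom_ext _ _ _ _ (ah_comp (xi_sym rho kappa) _)
  (ah_comp (quot_pi _) fa_rees)) => i.
by rewrite !ah_compE !word_liftE sym_liftE.
Qed.

Definition sym_bounded (m : nat) (x : GS) : Prop :=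
  forall g l, (m < l)%N -> sym_comp l (x g) = 0.

Lemma sym_boundedP : [/\ forall m, sym_bounded m 0,
  forall m u v, sym_bounded m u -> sym_bounded m v -> sym_bounded m (u + v),
  forall m a u, sym_bounded m u -> sym_bounded m (sc a * u),
  forall m g u, sym_bounded m u ->
    sym_bounded m (u * smash_grp (sym_act rho) g) &
  (forall m u, sym_bounded m u -> sym_bounded m.+1 u) /\
  (forall w, sym_bounded (size w) (sym_in (word F w)))].
Proof.
have lc := @klinear_sym_comp K V.
split=> [m g l _|m u v um vm g l ml|m a u um g l ml|m g' u um g l ml|].
- by rewrite ffunE (klinear0 (lc l)).
- by rewrite smash_addE (klinearD (lc l)) um // vm // addr0.
- by rewrite smash_scE (klinearZ (lc l)) um // mulr0.
- by rewrite smash_mul_grpE um.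
split=> [m u um g l /ltnW|w g l wl]; first exact: um.
rewrite ah_compE ffunE; case: eqP => _; last by rewrite (klinear0 (lc l)).
by rewrite sym_comp_word ltn_eqF.
Qed.

(** If [xi] kills [x], the degree [m] component of [x], lifted to H_kappa, lies in filtration degree
    m - 1. Its normal form then has degree below [m], yet its degree [m] part is the component
    itself, which must vanish. *)
Lemma xi_eq0 x : xi rho kappa x = 0 -> x = 0.
Proof.
move=> xi0; have [P0 PD PZ Pgrp [PS Psigma]] := sym_boundedP.
have /boolp.choice[f fx] : forall g, exists y, x g = @fa_sym K V n b F y.
  by move=> g; apply: (fa_sym_surj bP).
(* A representative of [xi x] in the Rees algebra. *)
pose p := \sum_g fa_rees (f g) * rees_mono (Hk_fil_grp rho kappa g).
have : quot_pi (rees_lower (Hk_fil rho kappa)) p = 0.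
  rewrite -xi0 (klinear_sum (klinear_hom (quot_pi _))).
  by apply: eq_bigr => g _; rewrite ahM -xi_fa_sym -fx.
move=> /quot_pi_eq0 p0; apply/ffunP => g; rewrite [RHS]ffunE.
apply: (sym_comp_eq0 bP F) => m.
pose y := \sum_h smash_inl (tens_act rho) (fa_tens (wcomp m (f h)))
   * smash_grp (tens_act rho) h.
have py : Hk_pi rho kappa y = p m.
  rewrite (klinear_sum (klinear_hom (Hk_pi rho kappa))).
  rewrite /p rees_sumE.
  by apply: eq_bigr => h _; rewrite ahM rees_mul_mono0 fa_rees_coef.
(* For positive [m], the image of [y] also has a representative [z] of word length at most m - 1,
   and [nf] agrees on [y] and [z]. *)
have nfy : lower sym_bounded m (nf y).
  have := p0 m; rewrite -py; case: (m) => [|m'] /=; first exact: nf_Hk0.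
  move=> /Hk_lift[z pz zm]; have -> : nf y = nf z.
    apply/eqP; rewrite -subr_eq0 -(klinearB klinear_nf); apply/eqP/nf_Hk0.
    by rewrite (klinearB (klinear_hom _)) pz subrr.
  rewrite /nf; elim/big_ind: _ => [|u v|h _]; [exact: P0|exact: PD|].
  by apply: (Pgrp); apply: (nform_wfil bP _ _ P0 PD PZ Pgrp PS Psigma).
have nfyE : nf y =
  \sum_h wext nf_word (wcomp m (f h)) * smash_grp (sym_act rho) h.
  by apply: eq_bigr => h _; rewrite smash_sum_inl_grpE fa_tensK.
pose s := \sum_h sym_in (wcomp m (f h)) * smash_grp (sym_act rho) h.
have low_s : lower sym_bounded m s.
  apply: (lower_subr PD PZ nfy).
  rewrite nfyE /s -sumrB; elim/big_ind: _ => [|u v|h _].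
  - exact: lower0 P0 _.
  - exact: lowerD PD _ _ _.
  rewrite -mulrBl; apply: (lower_grp Pgrp).
  by apply: (nform_lead_homog bP _ _ P0 PD PZ Pgrp PS Psigma); apply: wcomp_id.
have sg : s g = sym_comp m (x g).
  rewrite fx sym_comp_fa.
  exact: (smash_sum_inl_grpE (sym_act rho) (fun h => fa_sym F (wcomp m (f h)))).
(* [s g] is homogeneous of degree [m] and has degree below [m]; for [m = 0] the latter already says
   that [s] is zero. *)
rewrite -sg; case: (m) low_s sg => [->|m'] /=; first by rewrite ffunE.
by move=> low_s sg; rewrite sg -(sym_comp_id bP F) -sg; apply: low_s.
Qed.

End PBW.

(** * Surjectivity of xi and the Jacobi identity *)

Section Xi.
Context {K : fieldType} {V : vectType K} {gT : finGroupType}.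
Variables (rho : linrep gT V) (kappa : V -> V -> grpalg K gT).

(** [gr_class] takes a proof of membership as an argument, so this proof is quantified apart from
    the derivation used for induction. *)
Let xi_gr_class m x : Hk_fil rho kappa m x ->
  forall Fx : Hk_fil rho kappa m x, exists y, xi rho kappa y = gr_class Fx.
Proof.
elim=> {m x} [m x [g|v]|m||m x y Fx IHx Fy IHy|m a x Fx IHx
  |m l x y Fx IHx Fy IHy|m x Fx IHx] Fxy.
- exists (smash_grp (sym_act rho) g); rewrite xi_grp.
  exact: gr_class_irr.
- exists (smash_inl (sym_act rho) (svec v)); rewrite xi_vec.
  exact: gr_class_irr.
- exists 0; rewrite (klinear0 (klinear_hom _)); apply/esym/gr_class_eq0.
  exact: fil_pred0.
- exists 1; rewrite rmorph1 -gr_class1; exact: gr_class_irr.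
- have [x' x'E] := IHx Fx; have [y' y'E] := IHy Fy; exists (x' + y').
  rewrite ahD x'E y'E -gr_classD; exact: gr_class_irr.
- have [x' x'E] := IHx Fx; exists (sc a * x').
  rewrite ahM ah_sc x'E -gr_classZ; exact: gr_class_irr.
- have [x' x'E] := IHx Fx; have [y' y'E] := IHy Fy; exists (x' * y').
  rewrite ahM x'E y'E -gr_classM; exact: gr_class_irr.
(* An element of filtration degree [m] has class zero in degree m + 1. *)
- exists 0; rewrite (klinear0 (klinear_hom _)); apply/esym/gr_class_eq0.
  exact: Fx.
Qed.

Lemma xi_surj y : exists x, y = xi rho kappa x.
Proof.
move: y; apply: quot_ind => p; have [N pN] := rees_fin p.
have /boolp.choice[f fE] (m : nat) : exists x, xi rho kappa x =
  gr_class (rees_fil p m).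
  exact/xi_gr_class/rees_fil.
exists (\sum_(m < N) f m); rewrite (klinear_sum (klinear_hom _)).
transitivity (quot_pi (rees_lower (Hk_fil rho kappa))
    (\sum_(m < N) rees_mono (rees_fil p m))).
  congr (quot_pi _ _); apply: reesP => m.
  rewrite rees_sumE.
  have [lt_mN|le_Nm] := ltnP m N.
    rewrite (sum_single (i := Ordinal lt_mN)) ?rees_monoE ?eqxx // => j jm.
    rewrite rees_monoE; case: eqP => // mj; case/eqP: jm; exact: val_inj.
  rewrite pN // big1 // => j _; rewrite rees_monoE gtn_eqF //.
  exact: leq_trans le_Nm.
rewrite (klinear_sum (klinear_hom _)); apply: eq_bigr => m _.
by rewrite fE.
Qed.

Lemma ring_jacobi (A : pzRingType) (x y z : A) :
  ((x * y - y * x) * z - z * (x * y - y * x)) +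
  ((y * z - z * y) * x - x * (y * z - z * y)) +
  ((z * x - x * z) * y - y * (z * x - x * z)) = 0.
Proof.
rewrite !mulrBl !mulrBr !mulrA !opprB.
set a := x * y * z; set b1 := y * x * z; set c := z * x * y; set d := z * y * x.
set e := y * z * x; set f := x * z * y.
have sub4 (p q r s : A) : p - q + (r - s) =
  (p + r) - (q + s) by rewrite addrACA -opprD.
rewrite !sub4 (addrC d) (addrC f) (addrC c).
by rewrite (addrC _ (b1 + c)) addrA subrr.
Qed.

(** Expands the Jacobi identity for commutators in [A]: moving [u g] past [X z] replaces [z] by
    [rho g z], whence the differences. *)
Lemma comm_rel_jacobi (A : kalgType K) (X : V -> A) (u : gT -> A) :
  linear_to X -> (forall g v, u g * X v = X (rho g v) * u g) ->
  (forall x y, X x * X y - X y * X x = \sum_g sc (kappa x y g : K) * u g) ->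
  forall x y z, \sum_g X ((kappa x y g : K) *: (z - rho g z)
    + (kappa y z g : K) *: (x - rho g x)
    + (kappa z x g : K) *: (y - rho g y)) * u g = 0.
Proof.
move=> lX uX XX x y z.
have XN v : X (- v) = - X v by rewrite -scaleN1r (linear_toZ lX) scN1r.
have comm a b c : (X a * X b - X b * X a) * X c - X c * (X a * X b - X b * X a)
    = - \sum_g X ((kappa a b g : K) *: (c - rho g c)) * u g.
  rewrite XX mulr_suml mulr_sumr -sumrB -sumrN; apply: eq_bigr => g _.
  rewrite (linear_toZ lX) (linear_toD lX) XN -mulrA uX mulr_scA -mulrBr.
  by rewrite -mulrBl -mulNr -mulrN opprB mulrA.
have := ring_jacobi (X x) (X y) (X z); rewrite !comm -!opprD => /eqP.
rewrite oppr_eq0 => /eqP XJ; rewrite -[RHS]XJ -!big_split; apply: eq_bigr =>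
  g _ /=.
by rewrite !(linear_toD lX) !mulrDl.
Qed.

(** The Jacobi sums [J g] define an element of C[G] |>< SV whose image is represented by the degree
    one element with coefficient [HJ], that is, by zero. Injectivity and [svec_eq0] then give
    [J g = 0]. *)
Lemma xi_inj_jacobi : (forall x, xi rho kappa x = 0 -> x = 0) ->
  forall x y z g, (kappa x y g : K) *: (z - rho g z)
    + (kappa y z g : K) *: (x - rho g x) + (kappa z x g : K) *: (y - rho g y) =
      0.
Proof.
move=> xi_inj x y z.
pose J g : V := (kappa x y g : K) *: (z - rho g z)
    + (kappa y z g : K) *: (x - rho g x) + (kappa z x g : K) *: (y - rho g y).
have HJ : \sum_g Hk_vec rho kappa (J g) * Hk_grp rho kappa g = 0.
  apply: comm_rel_jacobi; [exact: Hk_vec_linear|exact: Hk_grp_vec|].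
  exact: Hk_comm.
pose u := \sum_g smash_inl (sym_act rho) (svec (J g)) * smash_grp (sym_act rho)
  g.
move=> g; apply: (svec_eq0 (vbasisP {:V})).
apply: etrans (esym (smash_sum_inl_grpE (sym_act rho) (fun h =>
  svec (J h)) g)) _.
rewrite -/u (xi_inj u) ?ffunE //.
pose p : rees (Hk_fil rho kappa) := \sum_h
  rees_mono (Hk_fil_vec rho kappa (J h)) * rees_mono (Hk_fil_grp rho kappa h).
transitivity (quot_pi (rees_lower (Hk_fil rho kappa)) p).
  rewrite /p !(klinear_sum (klinear_hom _)); apply: eq_bigr => h _.
  by rewrite ahM xi_vec xi_grp ahM.
rewrite (_ : p = 0); first exact: (klinear0 (klinear_hom _)).
apply: reesP => m; rewrite rees_sumE.
transitivity (if m == 1%N then \sum_h Hk_vec rho kappa (J h) * Hk_grp rho kappa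
  h else 0).
  rewrite (eq_bigr _ (fun h _ => rees_mul_mono0 _ _ _)).
  case: eqP => m1; last first.
    by apply: big1 => h _; rewrite rees_monoE; case: eqP; rewrite ?mul0r.
  by apply: eq_bigr => h _; rewrite rees_monoE m1.
by rewrite HJ; case: eqP.
Qed.

End Xi.

(** * Alternating forms and symplectic reflections *)

Section LinearAlgebra.
Context {K : fieldType} {V : vectType K}.

Lemma vbasis2 (U : {vspace V}) : \dim U = 2 -> exists e1 e2 : V,
  [/\ e1 \in U, e2 \in U, e1 != 0 &
      forall u, u \in U -> exists a b, u = a *: e1 + b *: e2].
Proof.
move=> U2; have bU := vbasisP U; move: (vbasis U) bU; rewrite U2 => t tU.
have tin (i : 'I_2) :
  t`_i \in U by rewrite (basis_mem tU) // mem_nth ?size_tuple.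
exists t`_0%N, t`_1%N; split=> [|| |u uU]; [exact: (tin ord0)|exact:
  (tin ord_max)| |].
  by apply: (free_not0 (basis_free tU)); rewrite mem_nth ?size_tuple.
exists (coord t ord0 u), (coord t (lift ord0 ord0) u).
by rewrite {1}(coord_basis tU uU) big_ord_recl big_ord1.
Qed.

Record alternating (w : V -> V -> K) : Prop := Alternating {
  alt_linear : forall a u v x, w (a *: u + v) x = a * w u x + w v x;
  alt_skew : forall x y, w x y = - w y x;
  altxx : forall x, w x x = 0
}.

Section Alternating.
Variables (w : V -> V -> K) (wA : alternating w).

Lemma altD u v x : w (u + v) x = w u x + w v x.
Proof. by have := alt_linear wA 1 u v x; rewrite scale1r mul1r. Qed.

Lemma alt0 x : w 0 x = 0.
Proof. by have := alt_linear wA (-1) 0 0 x; rewrite scaler0 addr0 mulN1r addNr.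
Qed.

Lemma altZ a u x : w (a *: u) x = a * w u x.
Proof. by rewrite -[a *: u]addr0 (alt_linear wA) alt0 addr0. Qed.

Lemma altB u v x : w (u - v) x = w u x - w v x.
Proof. by rewrite altD -scaleN1r altZ mulN1r. Qed.

Lemma altDr u v x : w x (u + v) = w x u + w x v.
Proof. by rewrite (alt_skew wA) altD opprD -!(alt_skew wA). Qed.

Lemma altZr a u x : w x (a *: u) = a * w x u.
Proof. by rewrite (alt_skew wA) altZ -mulrN -(alt_skew wA). Qed.

Lemma altBr u v x : w x (u - v) = w x u - w x v.
Proof. by rewrite (alt_skew wA) altB opprD -!(alt_skew wA). Qed.

Lemma alt_plane e1 e2 a b c d :
  w (a *: e1 + b *: e2) (c *: e1 + d *: e2) = (a * d - b * c) * w e1 e2.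
Proof.
rewrite !altD !altZ !altDr !altZr !(altxx wA) (alt_skew wA e2 e1); ring.
Qed.

Lemma alt_plane_jacobi (U : {vspace V}) x y z : \dim U = 2 ->
  x \in U -> y \in U -> z \in U ->
  w x y *: z + w y z *: x + w z x *: y = 0.
Proof.
move=> /vbasis2[e1 [e2 [_ _ _ e12]]] /e12[a [b ->]] /e12[c [d ->]] /e12[f [g
  ->]].
rewrite !alt_plane !scalerDr !scalerA (addrACA (_ *: e1)).
rewrite -!scalerDl addrACA -!scalerDl.
rewrite [X in X *: e1](_ : _ = 0) ?scale0r ?add0r; last by ring.
by rewrite [X in X *: e2](_ : _ = 0) ?scale0r //; ring.
Qed.

End Alternating.

Section Representation.
Context {gT : finGroupType} (rho : linrep gT V) (g : gT).
Hypothesis card_neq0 : #|gT|%:R != 0 :> K.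
Local Notation im := (im1B rho g).
Local Notation ker := (ker1B rho g).
Local Notation t := (\1 - rho g)%VF.

Lemma sub1E x : t x = x - rho g x.
Proof. by rewrite add_lfunE id_lfunE opp_lfunE. Qed.

Lemma mem_ker1B x : (x \in ker) = (rho g x == x).
Proof. by rewrite memv_ker sub1E subr_eq0 eq_sym. Qed.

Lemma mem_im1B x : t x \in im.
Proof. exact/memv_img/memvf. Qed.

(** If y = z - g z is fixed by [g], every difference g^i z - g^(i+1) z equals [y]. Summed over |G|
    steps they telescope to zero, so |G| y = 0. *)
Lemma capv_im1B_ker1B : (im :&: ker = 0)%VS.
Proof.
apply/eqP; rewrite -subv0; apply/subvP => y; rewrite memv_cap mem_ker1B memv0.
case/andP=> /memv_imgP[z _ yz] /eqP gy.
have gi i : rho (g ^+ i)%g y = y.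
  by elim: i => [|i IHi]; rewrite ?lr1 ?id_lfunE // expgSr lrM comp_lfunE gy.
have step i : rho (g ^+ i)%g z - rho (g ^+ i.+1)%g z = y.
  have -> : rho (g ^+ i.+1)%g z = rho (g ^+ i)%g (rho g z).
    by rewrite expgSr lrM comp_lfunE.
  by rewrite -linearB -[RHS](gi i) yz sub1E.
have : \sum_(0 <= i < #|gT|) (rho (g ^+ i.+1)%g z - rho (g ^+ i)%g z)
    = - (#|gT|%:R *: y).
  rewrite big_mkord -[LHS]opprK -sumrN; congr (- _).
  rewrite (eq_bigr (fun=> y)) => [|i _]; last by rewrite opprB step.
  by rewrite sumr_const card_ord scaler_nat.
rewrite telescope_sumr // -cardsT expg_cardG ?inE // expg0.
rewrite subrr.
move/esym/eqP; rewrite oppr_eq0 scaler_eq0 cardsT (negPf card_neq0) orFb.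
by [].
Qed.

Lemma addv_im1B_ker1B : (im + ker = fullv)%VS.
Proof.
apply/eqP; rewrite eqEdim subvf (dimv_disjoint_sum capv_im1B_ker1B).
by have := limg_ker_dim t fullv; rewrite capfv addnC => <-; apply: leqnn.
Qed.

Definition proj_im1B (x : V) : V := daddv_pi im ker x.

Lemma proj_im1B_mem x : proj_im1B x \in im. Proof. exact: memv_pi. Qed.

Lemma sub_proj_im1B x : x - proj_im1B x \in ker.
Proof.
have xE : daddv_pi im ker x + daddv_pi ker im x = x.
  by apply: daddv_pi_add; rewrite ?capv_im1B_ker1B // addv_im1B_ker1B memvf.
by rewrite -{1}xE addrC addKr memv_pi.
Qed.

Lemma sub1_proj x : t (proj_im1B x) = t x.
Proof.
apply/eqP; rewrite eq_sym -subr_eq0 -linearB -memv_ker.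
exact: sub_proj_im1B.
Qed.

Variables (w : V -> V -> K) (wA : alternating w).
Hypothesis w_inv : forall x y, w (rho g x) (rho g y) = w x y.

Lemma im1B_orth x y : x \in im -> y \in ker -> w x y = 0.
Proof.
case/memv_imgP=> z _ ->; rewrite mem_ker1B => /eqP gy.
by rewrite sub1E (altB wA) -{2}gy w_inv subrr.
Qed.

Lemma alt_proj x y : x \in im -> w x y = w x (proj_im1B y).
Proof.
move=> xU; apply/eqP; rewrite -subr_eq0 -(altBr wA); apply/eqP.
exact/im1B_orth/sub_proj_im1B.
Qed.

Hypothesis w_nondeg : forall x, (forall y, w x y = 0) -> x = 0.

(** A vector spanning [im] would be orthogonal to itself and to [ker], hence to all of V. *)
Lemma dim_im1B_neq1 : \dim im != 1.
Proof.
apply/negP => /eqP U1; have := vbasisP im; move: (vbasis im); rewrite U1 =>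
  b bU.
have e0 : b`_0%N != 0.
  by apply: (free_not0 (basis_free bU)); rewrite mem_nth ?size_tuple.
case/eqP: e0; apply: w_nondeg => y.
have bin : b`_0%N \in im by rewrite (basis_mem bU) // mem_nth ?size_tuple.
rewrite alt_proj // (coord_basis bU (proj_im1B_mem y)) big_ord1.
by rewrite (altZr wA) (altxx wA) mulr0.
Qed.

(** An alternating form on a plane is determined by its value at a spanning pair. For [w] this value
    is nonzero, as otherwise [e1] would be orthogonal to [im] and, by [alt_proj], to all of V. *)
Lemma alt_plane_prop (k : V -> V -> K) : alternating k -> \dim im = 2 ->
  exists c, forall x y, x \in im -> y \in im -> k x y = c * w x y.
Proof.
move=> kA /vbasis2[e1 [e2 [e1U e2U e1_neq0 e12]]].
have we : w e1 e2 != 0.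
  apply: contra e1_neq0 => /eqP w0; apply/eqP/w_nondeg => y.
  rewrite alt_proj //; have [a [b ->]] := e12 _ (proj_im1B_mem y).
  by rewrite (altDr wA) !(altZr wA) (altxx wA) w0 !mulr0 addr0.
exists (k e1 e2 / w e1 e2) => x y /e12[a [b ->]] /e12[c [d ->]].
by rewrite (alt_plane kA) (alt_plane wA) mulrCA divfK.
Qed.

Section Jacobi.
Variables (k : V -> V -> K) (kA : alternating k).

(** The sum is the image under 1 - g of the cyclic sum of the projections, which vanishes in the
    plane [im]. *)
Lemma refl_jacobi : \dim im = 2 ->
  (forall x y, k x y = k (proj_im1B x) (proj_im1B y)) ->
  forall x y z, k x y *: (z - rho g z) + k y z *: (x - rho g x)
    + k z x *: (y - rho g y) = 0.
Proof.
move=> U2 kp x y z.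
have pt u : t (proj_im1B u) = u - rho g u by rewrite sub1_proj sub1E.
transitivity (t (k (proj_im1B x) (proj_im1B y) *: proj_im1B z
    + k (proj_im1B y) (proj_im1B z) *: proj_im1B x
    + k (proj_im1B z) (proj_im1B x) *: proj_im1B y)).
  have tD u v : t (u + v) = t u + t v by rewrite linearD.
  have tZ a u : t (a *: u) = a *: t u by rewrite linearZ.
  by rewrite !tD !tZ !pt -(kp x y) -(kp y z) -(kp z x).
by rewrite (alt_plane_jacobi kA U2) ?proj_im1B_mem // linear0.
Qed.

Hypothesis jacobi : forall x y z, k x y *: (z - rho g z)
  + k y z *: (x - rho g x) + k z x *: (y - rho g y) = 0.

(* Choose [z] with [t z] outside the span of [X]: its coefficient [k x y] in the
   Jacobi identity must vanish. *)
Let jacobi_vanish (X : seq V) x y : t x \in <<X>>%VS -> t y \in <<X>>%VS ->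
  (size X < \dim im)%N -> k x y = 0.
Proof.
move=> xX yX lt_X; have /subvPn[_ /memv_imgP[z _ ->] zX] : ~~ (im <= <<X>>)%VS.
  apply: contraL lt_X => /dimvS le_imX; rewrite -leqNgt.
  exact: leq_trans le_imX (dim_span X).
apply: contraNeq zX => kxy; have := jacobi x y z; rewrite -!sub1E -addrA.
move/eqP; rewrite addr_eq0 => /eqP kz.
rewrite -[t z]scale1r -(mulVf kxy) -scalerA kz memvZ // memvN.
by apply: memvD; apply: memvZ.
Qed.

Lemma jacobi_eq0 : (2 < \dim im)%N -> forall x y, k x y = 0.
Proof.
move=> lt2 x y; apply: (jacobi_vanish (X := [:: t x; t y])) => //.
  by rewrite memv_span ?mem_head.
by rewrite memv_span ?inE ?eqxx ?orbT.
Qed.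

Lemma jacobi_proj : \dim im = 2 ->
  forall x y, k x y = k (proj_im1B x) (proj_im1B y).
Proof.
(* For [x] fixed by [g], the span of [t y] alone contains both images, and it is smaller than the
   plane [im]. *)
move=> U2; have k0 x y : x \in ker -> k x y = 0.
  rewrite memv_ker => /eqP tx; apply: (jacobi_vanish (X := [:: t y])).
  - by rewrite tx mem0v.
  - by rewrite memv_span ?mem_head.
  - by rewrite U2.
have kp x y : k x y = k (proj_im1B x) y.
  by apply/eqP; rewrite -subr_eq0 -(altB kA); apply/eqP/k0/sub_proj_im1B.
by move=> x y; rewrite kp (alt_skew kA) kp -(alt_skew kA).
Qed.

End Jacobi.

Lemma dim_im1B_eq0 : \dim im = 0 -> rho g = \1%VF.
Proof.
move/eqP; rewrite dimv_eq0 => /eqP U0; apply/lfunP => x.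
by have := mem_im1B x; rewrite U0 memv0 sub1E subr_eq0 id_lfunE eq_sym => /eqP.
Qed.

End Representation.

End LinearAlgebra.

(** * Conjugation of the spaces [im1B] and of the projections *)

Section Conjugation.
Context {K : fieldType} {V : vectType K} {gT : finGroupType}.
Variable rho : linrep gT V.
Hypothesis card_neq0 : #|gT|%:R != 0 :> K.

Lemma linrepK g x : rho g (rho g^-1%g x) = x.
Proof. by rewrite -comp_lfunE -lrM mulgV lr1 id_lfunE. Qed.

Lemma linrep_conj g s x : rho (g * s * g^-1)%g (rho g x) = rho g (rho s x).
Proof. by rewrite -[LHS]comp_lfunE -lrM mulgKV lrM comp_lfunE. Qed.

Lemma sub1_conj g s x :
  (\1 - rho (g * s * g^-1)%g)%VF (rho g x) = rho g ((\1 - rho s)%VF x).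
Proof. by rewrite !sub1E linrep_conj linearB. Qed.

Lemma proj_im1B_unique g x u :
  u \in im1B rho g -> x - u \in ker1B rho g -> proj_im1B rho g x = u.
Proof.
move=> uU xuW; apply/eqP;
  rewrite -subr_eq0 -memv0 -(capv_im1B_ker1B rho g card_neq0).
rewrite memv_cap; apply/andP; split; first by rewrite memvB ?proj_im1B_mem.
have -> : proj_im1B rho g x - u = (x - u) - (x - proj_im1B rho g x).
  by rewrite opprB [RHS]addrC subrKA.
by rewrite memvB // sub_proj_im1B.
Qed.

Lemma proj_im1B_id g x : x \in im1B rho g -> proj_im1B rho g x = x.
Proof. by move=> xU; apply: proj_im1B_unique => //; rewrite subrr mem0v. Qed.

Lemma proj_im1B_conj g s x :
  proj_im1B rho (g * s * g^-1)%g (rho g x) = rho g (proj_im1B rho s x).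
Proof.
apply: proj_im1B_unique.
  have /memv_imgP[z _ ->] := proj_im1B_mem rho s x.
  by rewrite -sub1_conj mem_im1B.
have := sub_proj_im1B rho s card_neq0 x; rewrite !memv_ker => /eqP sx.
by rewrite -linearB sub1_conj sx linear0.
Qed.

Lemma dim_im1B_conj g s : \dim (im1B rho (g * s * g^-1)%g) = \dim (im1B rho s).
Proof.
(* One inequality suffices: it is applied to conjugation by [g] and by its inverse. *)
have le g' s' : (\dim (im1B rho (g' * s' * g'^-1)%g) <= \dim (im1B rho s'))%N.
  have le_im : (im1B rho (g' * s' * g'^-1)%g <= rho g' @: im1B rho s')%VS.
    apply/subvP => _ /memv_imgP[z _ ->].
    by rewrite -(linrepK g' z) sub1_conj memv_img ?mem_im1B.
  apply: leq_trans (dimvS le_im) _.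
  by rewrite -(limg_ker_dim (rho g') (im1B rho s')) leq_addl.
apply/eqP; rewrite eqn_leq le /=.
have := le g^-1%g (g * s * g^-1)%g; rewrite invgK.
by rewrite !mulgA mulVg mul1g mulgKV.
Qed.

Lemma dim_im1B1 : \dim (im1B rho 1%g) = 0.
Proof.
apply/eqP; rewrite dimv_eq0 -subv0; apply/subvP => _ /memv_imgP[z _ ->].
by rewrite sub1E lr1 id_lfunE subrr mem0v.
Qed.

End Conjugation.

(** Packages a coefficient of kappa as a form to which the assumption on invariant forms applies. *)
Lemma alternating_skew_symmetric (K : fieldType) (V : vectType K)
    (k : V -> V -> K) : alternating k ->
  exists beta : {skew_symmetric V}, forall x y, beta x y = k x y.
Proof.
move=> kA.
have kl u' : GRing.linear_for *%R (k ^~ u') by move=> a u v; apply: alt_linear.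
have kr u : GRing.linear_for (idfun \; *%R) (k u).
  by move=> a v v'; rewrite (altDr kA) (altZr kA).
have kh x y : k x y = (-1) ^+ true * idfun (k y x).
  by rewrite expr1 mulN1r; apply: alt_skew.
pose B := bilinear_isBilinear.Build K V V K *%R (idfun \; *%R) k (kl, kr).
pose H := isHermitianSesquilinear.Build K V true idfun k kh.
pose beta : {skew_symmetric V} := HB.pack k B H.
by exists beta.
Qed.

(** * The coefficients of kappa and the Jacobi identity *)

Section CoefficientForms.
Context {K : fieldType} {V : vectType K} {gT : finGroupType}.
Variables (omega : {skew_symmetric V}) (rho : linrep gT V).
Variable kappa : {bilinear V -> V -> grpalg K gT}.
Hypothesis two_neq0 : 2 != 0 :> K.
Hypothesis card_neq0 : #|gT|%:R != 0 :> K.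
Hypothesis omega_symplectic : is_psymplectic omega.
Hypothesis rho_faithful : faithful_rep rho.
Hypothesis rho_symplectic : rep_invariant rho omega.
Hypothesis invariant_forms : forall beta : {skew_symmetric V},
  rep_invariant rho beta <-> exists a : K, forall x y, beta x y = a * omega x y.
Hypothesis kappa_alternating : forall x, kappa x x = 0.
Hypothesis kappa_equivariant : forall g x y,
  kappa (rho g x) (rho g y) = gconj g (kappa x y).

Lemma omega_alternating : alternating omega.
Proof.
have oN x y : omega x y = - omega y x by rewrite hermC expr1 mulN1r.
split=> // [a u v x|x]; first exact: linearPl.
have /eqP := oN x x; rewrite -addr_eq0 -mulr2n -mulr_natl mulf_eq0.
by rewrite (negPf two_neq0) => /eqP.
Qed.

Lemma omega_nondegenerate x : (forall y, omega x y = 0) -> x = 0.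
Proof.
move=> x0; have [/eqP rad0 _ _] := omega_symplectic.
by apply/eqP; rewrite -memv0 -rad0; apply/mem_orthovP => y _; apply: x0.
Qed.

Lemma kappa_coef_alternating g : alternating (fun x y => kappa x y g : K).
Proof.
split=> [a u v x|x y|x]; last by rewrite kappa_alternating ffunE.
  by rewrite linearPl !ffunE.
apply/eqP; rewrite -addr_eq0; apply/eqP.
have := kappa_alternating (x + y); rewrite linearDl 2!linearDr /=.
rewrite !kappa_alternating add0r addr0 => /(congr1 (fun f : grpalg K gT =>
  f g)).
by rewrite !ffunE.
Qed.

Lemma kappa_coef_equivariant h g x y :
  kappa (rho h x) (rho h y) g = kappa x y (g ^ h)%g.
Proof. by rewrite kappa_equivariant ffunE. Qed.

Lemma omega_refl_conj g s x y :
  omega_refl rho omega (g * s * g^-1)%g (rho g x) (rho g y) =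
  omega_refl rho omega s x y.
Proof.
rewrite -[LHS]/(omega (proj_im1B rho _ _) (proj_im1B rho _ _)).
by rewrite !(proj_im1B_conj _ card_neq0) rho_symplectic.
Qed.

(** Allows omega_s to be cancelled, which makes the function c well determined and hence
    invariant. *)
Lemma omega_refl_neq0 s : symp_refl rho s ->
  exists x y, omega_refl rho omega s x y != 0.
Proof.
move=> /eqP s2; have [e1 [e2 [e1U e2U /eqP e1_neq0 _]]] := vbasis2 s2.
apply: contrapT => w0; case: e1_neq0; apply: omega_nondegenerate => y.
rewrite (alt_proj card_neq0 omega_alternating (rho_symplectic s)) //.
rewrite -{1}(proj_im1B_id card_neq0 e1U).
by apply: contrapT => /eqP wy; apply: w0; exists e1, y.
Qed.

Definition symplectic_form_kappa : Prop :=
  exists (t : K) (c : gT -> K),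
    (forall g s, symp_refl rho s -> c (g * s * g^-1)%g = c s) /\
    (forall x y, kappa x y =
       (t * omega x y) *: gdelta _ 1%g
       - 2 *: \sum_(s | symp_refl rho s)
                (c s * omega_refl rho omega s x y) *: gdelta _ s).

Lemma symp_refl1 : symp_refl rho 1%g = false.
Proof. by rewrite /symp_refl dim_im1B1. Qed.

Lemma form_coefE (t : K) (c : gT -> K) x y g :
  ((t * omega x y) *: gdelta _ 1%g
       - 2 *: \sum_(s | symp_refl rho s)
                (c s * omega_refl rho omega s x y) *: gdelta _ s :
                  grpalg K gT) g
  = if g == 1%g then t * omega x y
    else if symp_refl rho g then - (2 * c g) * omega_refl rho omega g x y else
      0.
Proof.
rewrite !ffunE sum_ffunE.
have -> : \sum_(s | symp_refl rho s)
    ((c s * omega_refl rho omega s x y) *: gdelta K s) g =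
    if symp_refl rho g then c g * omega_refl rho omega g x y else 0.
  case: ifP => sg.
    rewrite (bigD1 g) //= !ffunE eqxx [_ *: _]mulr1 big1 ?addr0 // =>
      s /andP[_ sg'].
    by rewrite !ffunE eq_sym (negPf sg') [_ *: _]mulr0.
  apply: big1 => s ss; rewrite !ffunE; case: eqP => [gs|_]; last exact: mulr0.
  by rewrite gs ss in sg.
case: eqP => [->|_].
  by rewrite symp_refl1 [_ *: 0]mulr0 subr0; apply: mulr1.
rewrite [X in X - _]mulr0 sub0r.
case: ifP => _; last by rewrite [_ *: _]mulr0 oppr0.
by rewrite -[_ *: _]/(_ * _) mulrA mulNr.
Qed.

Lemma form_of_jacobi :
  (forall x y z g, (kappa x y g : K) *: (z - rho g z)
    + (kappa y z g : K) *: (x - rho g x)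
    + (kappa z x g : K) *: (y - rho g y) = 0) -> symplectic_form_kappa.
Proof.
move=> jacobi.
have wA := omega_alternating.
have kA := kappa_coef_alternating.
have [beta betaE] := alternating_skew_symmetric (kA 1%g).
have [t tE] : exists t, forall x y, beta x y = t * omega x y.
  apply/invariant_forms => g x y.
  by rewrite !betaE kappa_coef_equivariant conj1g.
have /boolp.choice[c0 c0E] s : exists c : K, symp_refl rho s -> forall x y,
    kappa x y s = c * omega_refl rho omega s x y.
  have [s2|] := boolP (symp_refl rho s); last by exists 0.
  have [c cE] := alt_plane_prop card_neq0 wA (rho_symplectic s)
    omega_nondegenerate (kA s) (eqP s2).
  exists c => _ x y.
  rewrite (jacobi_proj card_neq0 (kA s) (fun x y z => jacobi x y z s) (eqP s2)).
  by rewrite cE ?proj_im1B_mem.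
(* [c0 s] is the coefficient of omega_s in kappa_s; the factor -2 in the formula is divided out. *)
exists t, (fun s => - (c0 s / 2)); split=> [g s ss|x y].
  congr (- (_ / _)); have [x [y wxy]] := omega_refl_neq0 ss.
  have ss' : symp_refl rho (g * s * g^-1)%g by rewrite /symp_refl dim_im1B_conj.
  apply: (mulIf wxy); rewrite -(c0E _ ss) -(omega_refl_conj g) -(c0E _ ss').
  by rewrite kappa_coef_equivariant conjgE !mulgA mulVg mul1g mulgKV.
apply/ffunP => g; rewrite form_coefE.
case: eqP => [->|/eqP g1]; first by rewrite -tE betaE.
case: ifP => [sg|nsg].
  by rewrite mulrN opprK (mulrCA 2) divff // mulr1 -(c0E _ sg).
(* The rank of 1 - g is not 0 by faithfulness, not 1 by nondegeneracy and not 2 because [g] is no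
   reflection. *)
apply: (jacobi_eq0 (fun x y z => jacobi x y z g)).
have := dim_im1B_neq1 card_neq0 wA (rho_symplectic g) omega_nondegenerate.
move: nsg; rewrite /symp_refl; case: (\dim _) (@dim_im1B_eq0 _ _ _ rho g) =>
  [|[|[|]]] //.
move=> /(_ erefl) g_id; case/eqP: g1; apply: rho_faithful.
by rewrite g_id lr1.
Qed.

(** For [g = 1] the differences [z - rho g z] vanish, and for other [g] that are no reflections
    kappa_g is zero. For a reflection kappa_g factors through the idempotent projection, so
    [refl_jacobi] applies. *)
Lemma jacobi_of_form : symplectic_form_kappa ->
  forall g x y z, (kappa x y g : K) *: (z - rho g z)
    + (kappa y z g : K) *: (x - rho g x)
    + (kappa z x g : K) *: (y - rho g y) = 0.
Proof.
case=> t [c [_ kE]] g x y z.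
have kg u v : kappa u v g = if g == 1%g then t * omega u v
    else if symp_refl rho g then - (2 * c g) * omega_refl rho omega g u v else
      0.
  by rewrite kE form_coefE.
have [g1|g1] := eqVneq g 1%g.
  by rewrite g1 lr1 !id_lfunE !subrr !scaler0 !addr0.
have [sg|nsg] := boolP (symp_refl rho g); last first.
  by rewrite !kg (negPf g1) (negPf nsg) !scale0r !addr0.
apply: (refl_jacobi card_neq0 (kappa_coef_alternating g) (eqP sg)) => u v.
rewrite !kg (negPf g1) sg; congr (_ * _).
rewrite -[LHS]/(omega (proj_im1B rho g u) (proj_im1B rho g v)).
rewrite -[RHS]/(omega (proj_im1B rho g _) (proj_im1B rho g _)).
have pp v' : proj_im1B rho g (proj_im1B rho g v') = proj_im1B rho g v'.
  by rewrite (proj_im1B_id card_neq0) ?proj_im1B_mem.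
by rewrite !pp.
Qed.

Lemma xi_bijective_jacobi :
  bijective (xi rho kappa) <-> forall g x y z, (kappa x y g : K) *:
    (z - rho g z)
    + (kappa y z g : K) *: (x - rho g x)
    + (kappa z x g : K) *: (y - rho g y) = 0.
Proof.
split=> [/bij_inj xi_inj g x y z|jacobi].
  apply: xi_inj_jacobi => u xi0; apply: xi_inj.
  by rewrite xi0 (klinear0 (klinear_hom (xi rho kappa))).
(* Surjectivity supplies a right inverse [f]; what remains is that the kernel is zero. *)
have /boolp.choice[f fK] := @xi_surj K V gT rho kappa.
exists f => [x|y]; last by rewrite -fK.
apply/eqP; rewrite -subr_eq0; apply/eqP.
have kA := kappa_coef_alternating.
apply: (xi_eq0 (vbasisP fullv) (free_word_algebra _)
  (fun g y a u v => alt_linear (kA g) a u v y) (fun g => altxx (kA g))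
  (fun g => alt_skew (kA g)) kappa_coef_equivariant jacobi).
by rewrite (klinearB (klinear_hom (xi rho kappa))) -fK subrr.
Qed.

End CoefficientForms.

Theorem theorem8p6 (R : realType) (V : vectType R[i])
    (omega : {skew_symmetric V}) (gT : finGroupType) (rho : linrep gT V)
    (kappa : {bilinear V -> V -> grpalg R[i] gT})
    (omega_symplectic : is_psymplectic omega)
    (rho_faithful : faithful_rep rho)
    (rho_symplectic : rep_invariant rho omega)
    (invariant_forms : forall beta : {skew_symmetric V},
       rep_invariant rho beta <->
       exists a : R[i], forall x y, beta x y = a * omega x y)
    (kappa_alternating : forall x, kappa x x = 0)
    (kappa_equivariant : forall g x y,
       kappa (rho g x) (rho g y) = gconj g (kappa x y)) :
  bijective (xi rho kappa) <->
  exists (t : R[i]) (c : gT -> R[i]),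
    (forall g s, symp_refl rho s -> c (g * s * g^-1)%g = c s) /\
    (forall x y, kappa x y =
       (t * omega x y) *: gdelta _ 1%g
       - 2 *: \sum_(s | symp_refl rho s)
                (c s * omega_refl rho omega s x y) *: gdelta _ s).
Proof.
have two_neq0 : 2 != 0 :> R[i] by rewrite Num.Theory.pnatr_eq0.
have card_neq0 : #|gT|%:R != 0 :> R[i].
  by rewrite Num.Theory.pnatr_eq0 -lt0n; apply/card_gt0P; exists 1%g.
rewrite (xi_bijective_jacobi kappa_alternating kappa_equivariant); split.
  move=> jacobi; apply: form_of_jacobi => // x y z g; exact: jacobi.
exact: jacobi_of_form.
Qed.
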